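(* Let $n,m\ge1$ and $w\ge0$, and let $(B_q)_{q\in\mathbb{N}}$ be a sequence of balls in $\mathbb{R}^m/\mathbb{Z}^m$. If the sets $\bigl(A_{n,m}(\mathbf{q},B_{|\mathbf{q}|})\bigr)_{\mathbf{q}\in\mathbb{Z}^n\setminus\{\mathbf0\}}$ are $w$-QIA, then for every integer $k\ge0$ the sets $\bigl(A_{n+k,m}(\mathbf{q},|\mathbf{q}|^{-k/m}B_{|\mathbf{q}|})\bigr)_{\mathbf{q}\in\mathbb{Z}^{n+k}\setminus\{\mathbf0\}}$ are $\max(w-k,0)$-QIA.
   Context: For $\mathbf{q}\in\mathbb{Z}^n$, $|\mathbf{q}|=\max_i|q_i|$. Balls are max-norm balls in $\mathbb{R}^m/\mathbb{Z}^m$; $cB$ is the ball with the same centre as $B$ and radius multiplied by $c>0$; $|\cdot|$ is Lebesgue measure. $A_{n,m}(\mathbf{q},B)=\{\mathbf{x}\in[0,1]^{nm}:\mathbf{q}\mathbf{x}+\mathbf{p}\in B\text{ for some }\mathbf{p}\in\mathbb{Z}^m\}$ ($\mathbf{x}$ an $n\times m$ matrix, $\mathbf{q}\mathbf{x}$ the row-vector–matrix product). For a sequence of balls $\Psi=(B_q)_{q\in\mathbb{N}}$ and $w\ge0$, the sets $(A_{n,m}(\mathbf{q},B_{|\mathbf{q}|}))_{\mathbf{q}\ne\mathbf0}$ are called $w$-weakly quasi-independent on average ($w$-QIA) if \[ \limsup_{Q\to\infty}\Bigl(\sum_{1\le|\mathbf{q}|\le Q}|B_{|\mathbf{q}|}|\Bigr)^2\Bigl(\sum_{1\le|\mathbf{q}_1|\le|\mathbf{q}_2|\le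 Q}\Bigl(\frac{\gcd(|\mathbf{q}_1|,|\mathbf{q}_2|)}{|\mathbf{q}_1|}\Bigr)^w\Bigl|A_{n,m}(\mathbf{q}_1,B_{|\mathbf{q}_1|})\cap A_{n,m}\Bigl(\mathbf{q}_2,\Bigl(\tfrac{|\mathbf{q}_1|}{|\mathbf{q}_2|}\Bigr)^{w/m}B_{|\mathbf{q}_2|}\Bigr)\Bigr|\Bigr)^{-1}>0, \] where both sums range over $\mathbf{q},\mathbf{q}_1,\mathbf{q}_2\in\mathbb{Z}^n$. ($0$-QIA coincides with usual quasi-independence on average, and $w$-QIA implies $w'$-QIA for $w\le w'$.) *)

(* Defs.v *)
From HB Require Import structures.
From mathcomp Require Import all_boot all_order all_algebra.
From mathcomp Require Import all_classical all_reals all_analysis.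
Set Implicit Arguments. Unset Strict Implicit. Unset Printing Implicit Defensive.
Import Order.TTheory GRing.Theory Num.Theory.
Local Open Scope classical_set_scope.
Local Open Scope ring_scope.

Section Defs.
Variable R : realType.

Definition box (I : finType) (a b : I -> R) : set (I -> R) :=
  [set x | forall i, a i <= x i <= b i].

Definition leb_outer (I : finType) (A : set (I -> R)) : \bar R :=
  ereal_inf [set s : \bar R | exists (a b : nat -> I -> R),
    [/\ (forall k i, a k i <= b k i),
        A `<=` \bigcup_k box (a k) (b k) &
        s = (\sum_(0 <= k <oo) (\prod_(i : I) (b k i - a k i))%:E)%E]].

(* Lebesgue measure, as a real number (all sets used below have finite measure). *)
Definition leb (I : finType) (A : set (I -> R)) : R := fine (leb_outer A).

(* A max-norm tball in R^m/Z^m: centre and radius. *)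
Record tball (m : nat) := TBall { bcentre : 'I_m -> R; bradius : R }.

(* y (in R^m) represents a point of the torus lying in the tball B *)
Definition in_tball m (B : tball m) (y : 'I_m -> R) : Prop :=
  exists p : 'I_m -> int, forall j, `|y j - bcentre B j - (p j)%:~R| < bradius B.

Definition tscale m (c : R) (B : tball m) : tball m :=
  TBall (bcentre B) (c * bradius B).

(* Lebesgue measure |B| of the tball in R^m/Z^m (fundamental domain [0,1)^m) *)
Definition tball_meas m (B : tball m) : R :=
  leb [set y : 'I_m -> R | (forall j, 0 <= y j < 1) /\ in_tball B y].

Definition supnorm n (q : 'I_n -> int) : nat := \max_(i < n) `|q i|%N.

Definition qmul n m (q : 'I_n -> int) (x : 'I_n * 'I_m -> R) : 'I_m -> R :=
  fun j => \sum_(i < n) (q i)%:~R * x (i, j).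

Definition Aset n m (q : 'I_n -> int) (B : tball m) : set ('I_n * 'I_m -> R) :=
  [set x | (forall ij, 0 <= x ij <= 1) /\
     exists p : 'I_m -> int, in_tball B (fun j => qmul q x j + (p j)%:~R)].

(* integer vectors with |q| <= Q, encoded by k : 'I_n -> 'I_(2Q+1), q_i = k_i - Q *)
Definition qvec n Q (k : {ffun 'I_n -> 'I_(2 * Q + 1)}) : 'I_n -> int :=
  fun i => (k i)%:Z - Q%:Z.

Definition S1 n m (B : nat -> tball m) (Q : nat) : R :=
  \sum_(k : {ffun 'I_n -> 'I_(2 * Q + 1)} | (1 <= supnorm (qvec k))%N)
     tball_meas (B (supnorm (qvec k))).

Definition S2 n m (w : R) (B : nat -> tball m) (Q : nat) : R :=
  \sum_(k1 : {ffun 'I_n -> 'I_(2 * Q + 1)} | (1 <= supnorm (qvec k1))%N)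
  \sum_(k2 : {ffun 'I_n -> 'I_(2 * Q + 1)} |
          (supnorm (qvec k1) <= supnorm (qvec k2))%N)
    let a := supnorm (qvec k1) in let b := supnorm (qvec k2) in
    ((gcdn a b)%:R / a%:R) `^ w *
    leb (Aset (qvec k1) (B a) `&`
         Aset (qvec k2) (tscale ((a%:R / b%:R) `^ (w / m%:R)) (B b))).

Definition wQIA n m (w : R) (B : nat -> tball m) : Prop :=
  (0 < limn_esup (fun Q => ((S1 n B Q) ^+ 2 / S2 n w B Q)%:E))%E.

End Defs.

(* Main.v *)
Require Import Defs.
From HB Require Import structures.
From mathcomp Require Import all_boot all_order all_algebra.
From mathcomp Require Import all_classical all_reals all_analysis.
From mathcomp Require Import zify ring lra.
Set Implicit Arguments. Unset Strict Implicit. Unset Printing Implicit Defensive.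
Import Order.TTheory GRing.Theory Num.Theory.
Import numFieldNormedType.Exports.
Local Open Scope classical_set_scope.
Local Open Scope ring_scope.

(** For a prime p tending to infinity, the measure of A(q1, B1) /\ A(q2, B2) is
    the limit of the density of the matrices k over F_p for which k / p lies in
    the set. Linear forms are equidistributed over F_p. Hence for non-parallel
    q1, q2 the measure is the product |B1| |B2|, whereas for parallel ones it
    depends only on the norms t1, t2 and on the sign, not on the dimension. In
    the parallel case each coordinate of the condition describes a union of
    intersections of two arcs; shrinking both balls by a factor s <= 1 shrinks
    every nonempty intersection by a factor O(s).

    In dimension n + k both balls are shrunk by t1^(-k/m), once the weight
    exponent w - k is taken into account, so a parallel pair loses a factor
    t1^k. The weight gains (g / t1)^(-k), with g = gcd(t1, t2), and the parallel
    pairs of norms t1, t2 correspond to vectors of norm g, whose number grows by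
    g^k: these powers cancel. So the parallel part of the new double sum is at
    most a constant times the old one, and the rest is at most the square of the
    new simple sum, which dominates the old simple sum. If w < k one first
    raises w to k, which only decreases the double sum. Balls of radius larger
    than 1/2, which cover the torus before shrinking, are treated separately:
    when both are that large, the trivial bound by the measure of one set
    suffices. *)

(** * Grids and covers of the cube *)

(** All values are at least [floor u + 1], and their offsets from there are below [v - u]; the [+ 1]
    counts the offset 0. Working with an injection [f] serves grid indices as well as residues
    lifted to integers. *)
Lemma card_int_itv (R : realType) (T : finType) (S : {set T}) (f : T -> int)
    (u v : R) : {in S &, injective f} -> u <= v ->
  (forall z, z \in S -> u < (f z)%:~R < v) -> #|S|%:R <= v - u + 1.
Proof.
move=> injf uv fS.
have vu0 : 0 <= v - u by rewrite subr_ge0.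
pose m := Num.floor u + 1; pose K := Num.truncn (v - u).
have /andP[mu1 mu2] := floor_itv u.
have fm z : z \in S -> (0 <= f z - m) && (`|f z - m|%N < K.+1)%N.
  move=> /fS /andP[uf fv].
  have fm0 : 0 <= f z - m.
    have : (Num.floor u)%:~R < (f z)%:~R :> R by exact: le_lt_trans uf.
    rewrite ltr_int /m; lia.
  rewrite fm0 ltnS truncn_ge_nat //.
  rewrite -[X in X <= _]/((_%:Z)%:~R) gez0_abs // intrB /m.
  by apply: lerB; [exact: ltW | exact: ltW].
pose g z : 'I_K.+1 := inord `|f z - m|%N.
have injg : {in S &, injective g}.
  move=> x y xS yS /(congr1 val); have /andP[x0 xK] := fm _ xS.
  have /andP[y0 yK] := fm _ yS.
  rewrite /g /= !inordK // => h; apply: injf => //; lia.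
have : (#|S| <= K.+1)%N.
  by rewrite -(card_in_imset injg) -[leqRHS]card_ord; exact: max_card.
rewrite -(ler_nat R) => /le_trans; apply; rewrite -addn1 natrD lerD2r.
by rewrite truncn_le.
Qed.

Lemma cvg_big_prod (R : realType) (T : Type) (F : set_system T) (I : Type)
    (s : seq I) (f : I -> T -> R) (l : I -> R) : Filter F ->
  (forall i, f i x @[x --> F] --> l i) ->
  (\prod_(i <- s) f i x) @[x --> F] --> \prod_(i <- s) l i.
Proof.
move=> FF fl; elim: s => [|i s IH].
  under eq_fun do rewrite big_nil; rewrite big_nil; exact: cvg_cst.
under eq_fun do rewrite big_cons; rewrite big_cons.
exact: cvgM (fl i) IH.
Qed.

Lemma leq_card_cover (T J : finType) (S : J -> {set T}) :
  (forall x, exists j, x \in S j) -> (#|T| <= \sum_j #|S j|)%N.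
Proof.
move=> cov; under eq_bigr do rewrite -sum1_card big_mkcond.
rewrite exchange_big -sum1_card; apply: leq_sum => x _.
by have [j xj] := cov x; rewrite (bigD1 j) //= xj.
Qed.

(* [prod_topology] carries no canonical pointed structure, which [compact_cover] requires. *)
Definition pointed_prod (I : finType) (R : realType) :=
  prod_topology (fun _ : I => (R : topologicalType)).
HB.instance Definition _ I R := Topological.on (pointed_prod I R).
HB.instance Definition _ I R := isPointed.Build (pointed_prod I R) (fun=> 0).

Section Covers.
Variables (R : realType) (I : finType).
Implicit Types (a b : nat -> I -> R).

(** Continuity of the product at [d = 0]. It prices the enlargement of a closed box to an open
    one. *)
Lemma prod_slack (x : I -> R) (e : R) : 0 < e ->
  exists2 d : R, 0 < d & \prod_i (x i + d) <= \prod_i x i + e.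
Proof.
move=> e0.
have ct : (\prod_i (x i + d)) @[d --> 0^'+] --> \prod_i (x i + 0).
  apply: cvg_big_prod => i; apply: cvgD; first exact: cvg_cst.
  by apply: cvg_at_right_filter; exact: cvg_id.
move: ct => /cvgrPdist_lt/(_ _ e0) ct.
have [d [d0 de]] : exists d : R, 0 < d /\
    `|\prod_i (x i + 0) - \prod_i (x i + d)| < e.
  apply: (@filter_ex _ (0 : R)^'+); apply: filterI ct; exact: nbhs_right_gt.
exists d => //; move: de; under eq_bigr do rewrite addr0.
by rewrite ltr_norml => /andP[h _]; rewrite -lerBlDl; lra.
Qed.

(* Comparing the number of points of a fine grid in the cube and in the boxes. *)
Lemma finite_cover_ge (h : R) (M : nat) a b (e : R) : 0 < h -> 0 < e ->
  (forall k i, a k i <= b k i) ->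
  (forall x : I -> R, (forall i, 0 <= x i <= h) ->
     exists2 k, (k < M)%N & forall i, a k i < x i < b k i) ->
  h ^+ #|I| <= \sum_(k < M) \prod_i (b k i - a k i + e).
Proof.
(* The mesh [h / N] is at most [e], so the one extra grid point per side in [card_int_itv] costs at
   most [e] in length. *)
move=> h0 e0 ab cov; pose N := (Num.truncn (h / e)).+1.
have N0 : 0 < N%:R :> R by rewrite ltr0n.
have hNe : h / N%:R <= e.
  by rewrite ler_pdivrMr // mulrC -ler_pdivrMr //; exact/ltW/truncnS_gt.
pose pt (k : {ffun I -> 'I_N}) : I -> R := fun i => (k i)%:R * (h / N%:R).
pose S k : {set {ffun I -> 'I_N}} := [set f | [forall i, a k i < pt f i < b k i]]%SET.
have cardS k : #|S k|%:R * (h / N%:R) ^+ #|I| <= \prod_i (b k i - a k i + e).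
  pose sl i : {set 'I_N} := [set j : 'I_N | a k i < j%:R * (h / N%:R) < b k i]%SET.
  have -> : #|S k| = (\prod_i #|sl i|)%N.
    transitivity (foldr muln 1%N [seq #|sl i| | i : I]).
      rewrite -card_family; apply: eq_card => f; rewrite !inE.
      by apply/forallP/familyP => H i; have := H i; rewrite /sl /= ?inE.
    by rewrite foldrE big_image.
  rewrite natr_prod -prodr_const -big_split /=; apply: ler_prod => i _.
  rewrite mulr_ge0 ?ler0n ?divr_ge0 ?(ltW h0) ?(ltW N0) //=.
  have hN0 : 0 < h / N%:R by rewrite divr_gt0.
  rewrite -ler_pdivlMr //.
  apply: (@le_trans _ _ (b k i / (h / N%:R) - a k i / (h / N%:R) + 1)).
    apply: (@card_int_itv R _ _ (fun j : 'I_N => (j : nat)%:Z)).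
    - by move=> x y _ _ [] /val_inj.
    - by rewrite ler_pM2r ?invr_gt0.
    - by move=> z; rewrite inE /= ltr_pdivrMr // ltr_pdivlMr.
  rewrite ler_pdivlMr // mulrDl mulrBl !divfK ?gt_eqF // mul1r.
  by rewrite lerD2l.
have : (\sum_(k < M) #|S k|%:R : R) >= N%:R ^+ #|I|.
  rewrite -natr_sum -natrX ler_nat -[X in (X ^ _)%N]card_ord -card_ffun.
  apply: leq_card_cover => f.
  have [i|k kM fk] := cov (pt f).
    rewrite /pt mulr_ge0 ?ler0n ?divr_ge0 ?(ltW h0) ?(ltW N0) //=.
    rewrite mulrCA ler_piMr ?(ltW h0) // ler_pdivrMr // mul1r ler_nat.
    exact: ltnW.
  by exists (Ordinal kM) => //; rewrite inE; apply/forallP.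
move=> le1; apply: (@le_trans _ _ (\sum_(k < M) #|S k|%:R * (h / N%:R) ^+ #|I|)).
  rewrite -mulr_suml expr_div_n mulrCA ler_peMr ?exprn_ge0 ?(ltW h0) //.
  by rewrite ler_pdivlMr ?exprn_gt0 // mul1r.
by apply: ler_sum.
Qed.

(** Compactness of the cube, by Tychonoff's theorem. The finite subcover is completed to an initial
    segment of the indices, so that sums over it are partial sums of a series. *)
Lemma open_cube_subcover (h : R) a b :
  box (fun=> 0) (fun=> h) `<=` \bigcup_k [set x : I -> R | forall i, a k i < x i < b k i] ->
  exists M, forall x : I -> R, (forall i, 0 <= x i <= h) ->
     exists2 k, (k < M)%N & forall i, a k i < x i < b k i.
Proof.
move=> cov.
pose T := pointed_prod I R.
pose U k : set T := [set x | forall i, a k i < x i < b k i].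
have Uo k : open (U k).
  rewrite openE => x Ux; rewrite /interior.
  apply: (@filter_forall T I (fun i (y : T) => a k i < y i < b k i) (nbhs x)) => i.
  have : nbhs (proj i x) [set y : R | a k i < y < b k i].
    have : open [set y : R | a k i < y < b k i].
      by have := @interval_open R (BRight (a k i)) (BLeft (b k i)) isT isT;
        rewrite set_itvE.
    by move=> op; apply: open_nbhs_nbhs; split => //; exact: Ux.
  exact: (@proj_continuous I (fun=> R) i x).
have : @compact T (box (fun=> 0) (fun=> h)).
  have := @tychonoff I (fun=> R) (fun=> `[0, h]%classic) (fun=> @segment_compact R 0 h).
  congr (compact _); apply/seteqP; split => x /= H i; have := H i; by rewrite /= in_itv.
rewrite compact_cover => /(_ nat setT U) [|x /cov [k _ xk]|D _ Dcov].
- by move=> k _; exact: Uo.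
- by exists k.
exists (\max_(k <- finmap.enum_fset D) k).+1 => x hx.
have [|k kD xk] := Dcov x; first exact: hx.
by exists k => //; rewrite ltnS; apply: leq_bigmax_seq.
Qed.

(** The cube has outer measure at least its volume: each closed box is opened at a cost of
    [e / 2 ^ k.+1], compactness leaves finitely many boxes, and the grid count applies to these. *)
Lemma countable_cover_ge (h : R) a b : 0 < h -> (forall k i, a k i <= b k i) ->
  box (fun=> 0) (fun=> h) `<=` \bigcup_k box (a k) (b k) ->
  ((h ^+ #|I|)%:E <= \sum_(0 <= k <oo) (\prod_i (b k i - a k i))%:E)%E.
Proof.
move=> h0 ab cov; apply/lee_addgt0Pr => e e0.
have ek k : 0 < e / (2 ^ k.+1)%:R by rewrite divr_gt0 // ltr0n expn_gt0.
have /choice[d dP] : forall k, exists d, 0 < d /\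
    \prod_i (b k i - a k i + d) <= \prod_i (b k i - a k i) + e / (2 ^ k.+1)%:R.
  by move=> k; have [d] := prod_slack (fun i => b k i - a k i) (ek k); exists d.
(* Two thirds of [d k] widen the side at its two ends; the last third absorbs the slack [e'] of the
   grid count. *)
pose a' k i := a k i - d k / 3; pose b' k i := b k i + d k / 3.
have [|M fcov] := @open_cube_subcover h a' b'.
  move=> x /cov[k _ xk]; exists k => //= i; have /andP[x1 x2] := xk i.
  by have [d0 _] := dP k; rewrite /a' /b'; lra.
pose e' := \big[Num.min/1]_(k < M) (d k / 3).
have e'0 : 0 < e'.
  rewrite /e'; elim/big_ind : _ => // [x y x0 y0|k _]; first by rewrite lt_min x0.
  by have [d0 _] := dP k; rewrite divr_gt0.
have e'le (k : 'I_M) : e' <= d k / 3 by exact: bigmin_le_cond.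
have hM : (\sum_(k < M) (\prod_i (b k i - a k i) + e / (2 ^ k.+1)%:R)) >= h ^+ #|I|.
  have ab' k i : a' k i <= b' k i.
    by have [d0 _] := dP k; have := ab k i; rewrite /a' /b'; lra.
  have le1 := finite_cover_ge h0 e'0 ab' fcov.
  apply: le_trans le1 _; apply: ler_sum => k _.
  have [d0 /(le_trans _)] := dP k; apply; apply: ler_prod => i _.
  by have := ab k i; have := e'le k; rewrite /a' /b'; lra.
have ge0 k : (0 <= (\prod_i (b k i - a k i))%:E)%E.
  by rewrite lee_fin prodr_ge0 // => i _; rewrite subr_ge0.
apply: le_trans (epsilon_trick xpredT ge0 (ltW e0)).
apply: le_trans (@nneseries_lim_ge _ _ _ 0%N M _); last first.
  by move=> k _ _; rewrite adde_ge0 // lee_fin ltW.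
by rewrite big_mkord; under eq_bigr do rewrite -EFinD; rewrite sumEFin lee_fin.
Qed.

(* The boxes of the finite cover are put in front of those of a cover of [A]. *)
Lemma leb_outer_complement_ge (h : R) (A : set (I -> R)) (J : finType)
    (a b : J -> I -> R) : 0 < h ->
  (forall j i, a j i <= b j i) ->
  (forall x : I -> R, (forall i, 0 <= x i <= h) -> A x \/ exists j, box (a j) (b j) x) ->
  ((h ^+ #|I| - \sum_j \prod_i (b j i - a j i))%:E <= leb_outer A)%E.
Proof.
move=> h0 ab cov; apply: le_ereal_inf_tmp => s [a' [b' [ab' Acov ->]]].
pose f (a : J -> I -> R) (a' : nat -> I -> R) k :=
  if insub k is Some o then a (enum_val (o : 'I_#|J|)) else a' (k - #|J|)%N.
have fl (a1 : J -> I -> R) a1' (o : 'I_#|J|) : f a1 a1' o = a1 (enum_val o) by rewrite /f valK.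
have fr (a1 : J -> I -> R) a1' k : f a1 a1' (#|J| + k)%N = a1' k.
  by rewrite /f insubF ?addKn // ltnNge leq_addr.
have abf k i : f a a' k i <= f b b' k i by rewrite /f; case: insubP.
have fcov : box (fun=> 0) (fun=> h) `<=` \bigcup_k box (f a a' k) (f b b' k).
  move=> x /cov[/Acov[k _ xk]|[j xj]].
    by exists (#|J| + k)%N => //; rewrite !fr.
  by exists (enum_rank j) => //; rewrite !fl enum_rankK.
have {fcov} := countable_cover_ge h0 abf fcov.
rewrite (@nneseries_split _ _ 0 #|J|); last first.
  by move=> k _; rewrite lee_fin prodr_ge0 // => i _; rewrite subr_ge0.
rewrite add0n big_mkord sumEFin.
have -> : \sum_(k < #|J|) \prod_i (f b b' k i - f a a' k i) =
    \sum_j \prod_i (b j i - a j i).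
  rewrite [RHS](reindex (@enum_val J predT)) /=; last first.
    by exists enum_rank => x _; rewrite ?enum_rankK ?enum_valK.
  by apply: eq_bigr => k _; apply: eq_bigr => i _; rewrite !fl.
rewrite -nneseries_addn; last first.
  by move=> k; rewrite lee_fin prodr_ge0 // => i _; rewrite subr_ge0.
under eq_eseriesr do rewrite addnC.
under [X in (_ <= _ + X)%E -> _]eq_eseriesr do
  (under eq_bigr do rewrite !fr).
by rewrite EFinB leeBlDl.
Qed.

(** The finite cover is padded to a sequence with degenerate boxes at the origin. Their volume is 0
    because [I] is nonempty; an empty product would be 1. *)
Lemma leb_outer_finite_cover_le (A : set (I -> R)) (J : finType)
    (a b : J -> I -> R) : (0 < #|I|)%N -> (forall j i, a j i <= b j i) ->
  (forall x, A x -> exists j, box (a j) (b j) x) ->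
  (leb_outer A <= (\sum_j \prod_i (b j i - a j i))%:E)%E.
Proof.
move=> /card_gt0P[i0 _] ab cov.
pose f (a : J -> I -> R) k : I -> R :=
  if insub k is Some o then a (enum_val (o : 'I_#|J|)) else fun=> 0.
have fl (a1 : J -> I -> R) (o : 'I_#|J|) : f a1 o = a1 (enum_val o) by rewrite /f valK.
have fr (a1 : J -> I -> R) k : f a1 (#|J| + k)%N = fun=> 0.
  by rewrite /f insubF // ltnNge leq_addr.
apply: ereal_inf_lbound; exists (f a), (f b); split.
- by move=> k i; rewrite /f; case: insubP.
- by move=> x /cov[j xj]; exists (enum_rank j) => //; rewrite !fl enum_rankK.
rewrite (@nneseries_split _ _ 0 #|J|); last first.
  move=> k _; rewrite lee_fin prodr_ge0 // => i _; rewrite subr_ge0.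
  by rewrite /f; case: insubP.
rewrite add0n big_mkord sumEFin eseries0 ?adde0; last first.
  move=> k kJ _; rewrite -(subnKC kJ) !fr.
  by rewrite (bigD1 i0) //= subrr mul0r.
congr EFin; rewrite (reindex (@enum_val J predT)) /=; last first.
  by exists enum_rank => x _; rewrite ?enum_rankK ?enum_valK.
by apply: eq_bigr => k _; apply: eq_bigr => i _; rewrite !fl.
Qed.

End Covers.

(** * Densities on finite types *)

Lemma in_asbool (T : finType) (P : T -> Prop) x :
  (x \in [set y | `[< P y >]]%SET) = `[< P x >].
Proof. by rewrite finset.inE. Qed.

Lemma card_asbool (T : finType) (P : T -> Prop) :
  #|[set x | `[< P x >]]%SET| = (\sum_x `[< P x >])%N.
Proof.
by rewrite -sum1_card big_mkcond; apply: eq_bigr => v _; rewrite in_asbool; case: asboolP.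
Qed.

Definition density (R : realType) (T : finType) (P : T -> Prop) : R :=
  #|[set x | `[< P x >]]%SET|%:R / #|T|%:R.

Section Density.
Variable R : realType.
Local Notation density := (density R).
Implicit Types T U : finType.

Lemma density_ge0 T (P : T -> Prop) : 0 <= density P.
Proof. by rewrite divr_ge0. Qed.

Lemma le_density T (P Q : T -> Prop) :
  (forall x, P x -> Q x) -> density P <= density Q.
Proof.
move=> PQ; apply: ler_wpM2r; first by rewrite invr_ge0.
rewrite ler_nat; apply: subset_leq_card; apply/fintype.subsetP => x; rewrite !in_asbool.
by move=> /asboolP Px; apply/asboolP; exact: PQ.
Qed.

Lemma eq_density T (P Q : T -> Prop) :
  (forall x, P x <-> Q x) -> density P = density Q.
Proof. by move=> PQ; apply/le_anti/andP; split; apply: le_density => x /PQ. Qed.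

Lemma density_le1 T (P : T -> Prop) : density P <= 1.
Proof.
rewrite /density; have [->|T0] := eqVneq #|T| 0%N; first by rewrite invr0 mulr0.
by rewrite ler_pdivrMr ?ltr0n ?lt0n // mul1r ler_nat max_card.
Qed.

Lemma density_not T (P : T -> Prop) : (0 < #|T|)%N ->
  density (fun x => ~ P x) = 1 - density P.
Proof.
move=> T0; have T1 : #|T|%:R != 0 :> R by rewrite pnatr_eq0 -lt0n.
rewrite /density (_ : [set x | `[< ~ P x >]]%SET = ~: [set x | `[< P x >]]%SET)%SET.
  by rewrite cardsCs finset.setCK natrB ?max_card // mulrBl divff.
by apply/setP => x; rewrite finset.in_setC !in_asbool asbool_neg.
Qed.

Lemma density_or T (P Q : T -> Prop) :
  density (fun x => P x \/ Q x) <= density P + density Q.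
Proof.
rewrite /density -mulrDl -natrD; apply: ler_wpM2r; first by rewrite invr_ge0.
rewrite ler_nat -cardsUI; apply: leq_trans (leq_addr _ _).
by apply: subset_leq_card; apply/fintype.subsetP => x; rewrite finset.in_setU !in_asbool asbool_or.
Qed.

Lemma density_exists T U (P : U -> T -> Prop) :
  density (fun x => exists u, P u x) <= \sum_u density (P u).
Proof.
rewrite /density -mulr_suml -natr_sum; apply: ler_wpM2r; first by rewrite invr_ge0.
rewrite ler_nat card_asbool (eq_bigr _ (fun u _ => card_asbool (P u))).
rewrite exchange_big; apply: leq_sum => x _.
by case: asboolP => // -[u Pu]; rewrite (bigD1 u) //= asboolT.
Qed.

(* [tV w] and [tW w] are translations by [w] in the source and in the target. *)
Lemma density_equidistributed T U (f : T -> U) (tV : U -> T -> T) (tW : U -> U -> U)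
    (P : U -> Prop) : (0 < #|T|)%N -> (0 < #|U|)%N ->
  (forall w, injective (tV w)) -> (forall w v, f (tV w v) = tW w (f v)) ->
  (forall u, injective (tW^~ u)) ->
  density (fun v => P (f v)) = density P.
Proof.
move=> T0 U0 tVi ftV tWi.
have E : (#|[set v | `[< P (f v) >]]%SET| * #|U| = #|[set w | `[< P w >]]%SET| * #|T|)%N.
  rewrite !card_asbool !(mulnC _ #|_|) -!sum_nat_const /=.
  transitivity (\sum_(w : U) \sum_(v : T) `[< P (tW w (f v)) >])%N.
    apply: eq_bigr => w _; rewrite (reindex_inj (tVi w)) /=.
    by apply: eq_bigr => v _; rewrite ftV.
  rewrite exchange_big; apply: eq_bigr => v _ /=.
  by rewrite [RHS](reindex_inj (tWi (f v))).
rewrite /density; apply/eqP; rewrite eqr_div ?pnatr_eq0 -?lt0n //.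
by rewrite -!natrM E.
Qed.

Lemma density_ffun (J T : finType) (P : J -> T -> Prop) :
  density (fun w : {ffun J -> T} => forall j, P j (w j)) = \prod_j density (P j).
Proof.
rewrite /density card_ffun natrX big_split /= prodr_const exprVn -natr_prod; congr (_%:R / _).
transitivity (foldr muln 1%N [seq #|[set x | `[< P j x >]]%SET| | j : J]).
  rewrite -card_family; apply: eq_card => w; rewrite in_asbool.
  apply/asboolP/familyP => [H j|H j]; first by rewrite in_asbool; exact/asboolP.
  by have := H j; rewrite in_asbool => /asboolP.
by rewrite foldrE big_image.
Qed.

Lemma density_pair T U (P : T -> Prop) (Q : U -> Prop) :
  density (fun x : T * U => P x.1 /\ Q x.2) = density P * density Q.
Proof.
rewrite /density [RHS]mulrACA -invfM -!natrM -card_prod -cardsX; congr (_%:R / _).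
by apply: eq_card => -[x y]; rewrite in_asbool finset.in_setX !in_asbool asbool_and.
Qed.
End Density.

(** The condition that the distance from [y] to the nearest integer is below [r]. It fails for every
    [y] when [r <= 0], so radii may be lowered past 0. *)
Definition near_int (R : realType) (r y : R) : Prop :=
  exists z : int, `|y - z%:~R| < r.

Section NearInt.
Variable R : realType.
Implicit Types (r y : R).

Lemma near_int_le r r' y : r <= r' -> near_int r y -> near_int r' y.
Proof. by move=> rr' [z zr]; exists z; apply: lt_le_trans rr'. Qed.

Lemma near_int_add (z : int) r y : near_int r (y + z%:~R) <-> near_int r y.
Proof.
split => -[e er]; last by exists (e + z); rewrite intrD opprD addrACA subrr addr0.
by exists (e - z); move: er; rewrite intrB opprB addrA.
Qed.

Lemma near_int_perturb r y y' d : `|y - y'| <= d -> near_int r y -> near_int (r + d) y'.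
Proof.
move=> yd [z zr]; exists z; rewrite (_ : y' - _ = (y - z%:~R) - (y - y')); last by ring.
by apply: le_lt_trans (ler_normB _ _) _; apply: ltr_leD.
Qed.

Lemma near_int_big r y : 1 / 2 < r -> near_int r y.
Proof.
move=> r2; have /andP[f1 f2] := floor_itv y; rewrite intrD in f2.
have [h|h] := lerP (y - (Num.floor y)%:~R) (1 / 2).
  by exists (Num.floor y); rewrite ger0_norm; lra.
by exists (Num.floor y + 1); rewrite intrD ler0_norm; lra.
Qed.

(** If [z] is the witness for the larger radius, then [y] is within [d] of [z + r] or of [z - r];
    doubling [d] turns this weak inequality into a strict one. *)
Lemma near_int_shell r d y : 0 < d -> near_int (r + d) y -> ~ near_int (r - d) y ->
  near_int (2 * d) (y - r) \/ near_int (2 * d) (y + r).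
Proof.
move=> d0 [z zr] nr; have : r - d <= `|y - z%:~R|.
  by rewrite leNgt; apply/negP => h; apply: nr; exists z.
move: zr; have [h|h] := ger0P (y - z%:~R) => h1 h2; [left|right]; exists z; rewrite ltr_norml; lra.
Qed.
End NearInt.

(** * Measures of Bohr sets as limits over prime fields *)

(** An inhomogeneous Bohr set. The free index type [C] allows the coordinates of one ball as well as
    those of two balls at once. *)
Definition bohr (R : realType) (I C : finType) (L : C -> I -> int) (th r : C -> R) :
    set (I -> R) :=
  [set x | forall c, near_int (r c) (\sum_i (L c i)%:~R * x i - th c)].

Definition grid_point (R : realType) (I : finType) (N : nat) (k : {ffun I -> 'I_N}) :
    I -> R :=
  fun i => (k i)%:R / N%:R.

Section Grid.
Variables (R : realType) (I C : finType).
Implicit Types (L : C -> I -> int) (th r : C -> R).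

Lemma bohr_perturb L th r (d e : R) (x y : I -> R) :
  (forall i, `|x i - y i| <= e) -> (forall c, (\sum_i `|L c i|%:~R) * e <= d) ->
  bohr L th r x -> bohr L th (fun c => r c + d) y.
Proof.
move=> xy Ld Bx c; apply: near_int_perturb (Bx c).
rewrite opprB addrA subrK -sumrB.
apply: le_trans (ler_norm_sum _ _ _) _; apply: le_trans (Ld c).
rewrite mulr_suml; apply: ler_sum => i _; rewrite -mulrBr normrM.
by rewrite intr_norm ler_wpM2l.
Qed.

Lemma grid_cell (N : nat) (y : R) : (0 < N)%N -> 0 <= y <= 1 ->
  exists k : 'I_N, k%:R / N%:R <= y <= k.+1%:R / N%:R.
Proof.
case: N => // N _ /andP[y0 y1].
have N0 : 0 < N.+1%:R :> R by rewrite ltr0n.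
have yN : 0 <= y * N.+1%:R by rewrite mulr_ge0 // ler0n.
have /andP[t1 t2] := truncn_itv yN.
have [h|h] := ltnP (Num.truncn (y * N.+1%:R)) N.+1.
  by exists (Ordinal h); rewrite /= ler_pdivrMr // ler_pdivlMr // t1 ltW.
(* Only [y = 1] reaches this case; it is put into the last closed cell. *)
exists ord_max; rewrite /= divff ?pnatr_eq0 // y1 andbT ler_pdivrMr //.
by apply: le_trans t1; rewrite ler_nat ltnW.
Qed.

Lemma grid_cell_ffun (N : nat) (x : I -> R) : (0 < N)%N -> (forall i, 0 <= x i <= 1) ->
  exists k : {ffun I -> 'I_N}, box (grid_point R k) (fun i => (k i).+1%:R / N%:R) x.
Proof.
move=> N0 x01; have /choice[k kP] := fun i => grid_cell N0 (x01 i).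
by exists (finfun k) => i; rewrite /grid_point ffunE.
Qed.

Lemma grid_cell_norm (N : nat) (k : {ffun I -> 'I_N}) (x : I -> R) :
  box (grid_point R k) (fun i => (k i).+1%:R / N%:R) x ->
  forall i, `|x i - grid_point R k i| <= N%:R^-1.
Proof.
move=> bx i; have /andP[x1 x2] := bx i.
rewrite ger0_norm ?subr_ge0 // lerBlDl; apply: le_trans x2 _.
by rewrite -addn1 natrD mulrDl mul1r.
Qed.

(** Cells failing [P] are collapsed to the origin, so that the family stays indexed by all grid
    points; they have volume 0 since [I] is nonempty. *)
Lemma grid_cells_volume (N : nat) (P : {ffun I -> 'I_N} -> Prop) : (0 < #|I|)%N -> (0 < N)%N ->
  \sum_(k : {ffun I -> 'I_N}) \prod_i
    ((if `[< P k >] then (k i).+1%:R / N%:R else 0 : R) -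
     (if `[< P k >] then grid_point R k i else 0)) = density R P.
Proof.
move=> /card_gt0P[i0 _] N0; rewrite /density card_asbool natr_sum mulr_suml.
apply: eq_bigr => k _; case: asboolP => _; last first.
  by rewrite mul0r (bigD1 i0) //= subrr mul0r.
rewrite mul1r card_ffun card_ord natrX -exprVn -prodr_const; apply: eq_bigr => i _.
by rewrite /grid_point -addn1 natrD mulrDl addrC addKr mul1r.
Qed.

(** Left continuity of [h ^+ d] at 1; this is how the half-open unit cube is exhausted by closed
    cubes of side [h < 1]. *)
Lemma le1_of_expr_lt1 (d : nat) (y : R) : (forall h, 0 < h < 1 -> h ^+ d <= y) -> 1 <= y.
Proof.
move=> hy; have c1 : (h ^+ d) @[h --> 1^'-] --> (1 ^+ d : R).
  apply: cvg_at_left_filter; exact: exprn_continuous.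
rewrite -[1](expr1n R d); apply: (ler_cvg_to c1 (cvg_cst y)).
near=> h; apply: hy; apply/andP; split; near: h.
  by apply: nbhs_left_gt.
exact: nbhs_left_lt.
Unshelve. all: by end_near. Qed.

Variables (L : C -> I -> int) (th r : C -> R) (A : set (I -> R)).
Hypothesis I0 : (0 < #|I|)%N.
Hypothesis Aupper : A `<=` box (fun=> 0) (fun=> 1) `&` bohr L th r.

(** A cell that meets the Bohr set has its lower corner in the Bohr set enlarged by [d], so the
    cells with such corners cover [A]. *)
Lemma leb_outer_le_grid (N : nat) (d : R) : (0 < N)%N ->
  (forall c, (\sum_i `|L c i|%:~R) / N%:R <= d) ->
  (leb_outer A <= (density R (fun k : {ffun I -> 'I_N} =>
      bohr L th (fun c => r c + d)%R (grid_point R k)))%:E)%E.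
Proof.
move=> N0 Ld; rewrite -grid_cells_volume //.
apply: leb_outer_finite_cover_le => // [k i|x /Aupper[x01 xB]].
  case: asboolP => // _; rewrite /grid_point ler_wpM2r ?invr_ge0 //.
  by rewrite ler_nat.
have [k xk] := grid_cell_ffun N0 x01; exists k.
by rewrite asboolT //; apply: bohr_perturb xB; first exact: grid_cell_norm.
Qed.

Hypothesis Alower : forall x, (forall i, 0 <= x i < 1) -> bohr L th r x -> A x.

(** A point outside the Bohr set lies in a cell whose corner fails the conditions reduced by [d].
    These cells and [A] together cover the cube of side [h], and [h] tends to 1. Taking [h < 1]
    keeps the points in the half-open cube, where [Alower] applies. *)
Lemma leb_outer_ge_grid (N : nat) (d : R) : (0 < N)%N ->
  (forall c, (\sum_i `|L c i|%:~R) / N%:R <= d) ->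
  ((density R (fun k : {ffun I -> 'I_N} =>
      bohr L th (fun c => r c - d)%R (grid_point R k)))%:E <= leb_outer A)%E.
Proof.
move=> N0 Ld; pose P (k : {ffun I -> 'I_N}) := bohr L th (fun c => r c - d) (grid_point R k).
have T0 : (0 < #|{ffun I -> 'I_N}|)%N by rewrite card_ffun card_ord expn_gt0 N0.
have key (h : R) : 0 < h < 1 -> ((h ^+ #|I| - density R (fun k => ~ P k))%:E <= leb_outer A)%E.
  move=> /andP[h0 h1]; rewrite -grid_cells_volume //.
  apply: leb_outer_complement_ge => // [k i|x xh].
    case: asboolP => // _; rewrite /grid_point ler_wpM2r ?invr_ge0 //.
    by rewrite ler_nat.
  have [xB|xB] := pselect (bohr L th r x).
    left; apply: Alower => // i; have /andP[-> xih] := xh i.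
    exact: le_lt_trans h1.
  have x01 i : 0 <= x i <= 1.
    by have /andP[-> xih] := xh i; apply: le_trans (ltW h1).
  right; have [k xk] := grid_cell_ffun N0 x01; exists k.
  rewrite asboolT // => Pk; apply: xB.
  have := @bohr_perturb L th (fun c => r c - d) d N%:R^-1 (grid_point R k) x.
  under [X in bohr L th X x]eq_fun do rewrite subrK; apply => //.
  by move=> i; rewrite distrC; apply: grid_cell_norm.
rewrite density_not // in key; rewrite -/P.
case: (leb_outer A) key => [l| |] key; last 2 first.
- exact: leey.
- have h : 0 < (1 / 2 : R) < 1 by lra.
  by have := key _ h; rewrite leeNy_eq.
rewrite lee_fin -subr_ge0 -(lerD2r 1) add0r.
by apply: (@le1_of_expr_lt1 #|I|) => h /key; rewrite lee_fin; lra.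
Qed.

(** The upper bound makes the outer measure finite, so that [fine] does not replace it by its
    default value. The hypotheses on [A] fit both the closed cube of [Aset] and the half-open one of
    [tball_meas]. *)
Lemma leb_grid (N : nat) (d : R) : (0 < N)%N ->
  (forall c, (\sum_i `|L c i|%:~R) / N%:R <= d) ->
  density R (fun k : {ffun I -> 'I_N} => bohr L th (fun c => r c - d) (grid_point R k))
    <= leb A <=
  density R (fun k : {ffun I -> 'I_N} => bohr L th (fun c => r c + d) (grid_point R k)).
Proof.
move=> N0 Ld; have := leb_outer_le_grid N0 Ld; have := leb_outer_ge_grid N0 Ld.
by rewrite /leb; case: (leb_outer A) => [l| |] //=; rewrite !lee_fin => -> ->.
Qed.
End Grid.

(** * Limits along the primes and linear forms modulo p *)

Definition primes_oo : set_system nat := within [set p | prime p] \oo.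

Lemma primes_oo_proper : ProperFilter primes_oo.
Proof.
apply: Build_ProperFilter_ex => P [N _ NP].
by have [p Np pp] := prime_above N; exists p; apply: NP => //=; exact: ltnW.
Qed.
#[global] Existing Instance primes_oo_proper.

Lemma near_primes (P : nat -> Prop) (N : nat) :
  (forall p, prime p -> (N < p)%N -> P p) -> \forall p \near primes_oo, P p.
Proof. by move=> NP; exists N.+1 => // p /= Np pp; apply: NP. Qed.

Definition fp_near (R : realType) (p : nat) (t r : R) (z : 'F_p) : Prop :=
  near_int r ((z : nat)%:R / p%:R - t).

Lemma Fp_int_eq0 (p : nat) (z : int) : prime p ->
  (z%:~R == 0 :> 'F_p) = (p %| `|z|)%N.
Proof.
move=> pp; rewrite (dvdn_pcharf (pchar_Fp pp)).
by case: z => n; rewrite ?NegzE ?mulrNz ?oppr_eq0 //= ?abszN.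
Qed.

Section Fp.
Variables (R : realType) (p : nat).
Hypothesis pp : prime p.
Implicit Types (t r : R).

Let p0 : 0 < p%:R :> R. Proof. by rewrite ltr0n prime_gt0. Qed.

(** Changing [z] by a multiple of [p] changes [z / p] by an integer, so the condition descends to
    the residue class. *)
Lemma near_int_Fp t r (z : int) : near_int r (z%:~R / p%:R - t) <-> fp_near t r (z%:~R : 'F_p).
Proof.
have : (p %| `|z - ((z%:~R : 'F_p) : nat)%:Z|)%N.
  by rewrite -Fp_int_eq0 // rmorphB /= -pmulrn natr_Zp subrr.
rewrite -[X in (X %| _)%N]/(`|p%:Z|%N) -dvdzE => /dvdzP[e ez].
rewrite /fp_near (_ : z%:~R / p%:R - t = ((z%:~R : 'F_p) : nat)%:R / p%:R - t + e%:~R).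
  exact: near_int_add.
have -> : (z%:~R : R) = e%:~R * p%:R + ((z%:~R : 'F_p) : nat)%:R.
  move/(congr1 (fun x : int => x%:~R : R)): ez.
  by rewrite rmorphB rmorphM /= => /eqP; rewrite subr_eq => /eqP.
by rewrite mulrDl mulfK ?gt_eqF //; ring.
Qed.

(** Each residue that satisfies the condition is lifted by a multiple of [p] to an integer strictly
    between [(t - r) p] and [(t + r) p]; distinct residues have distinct lifts, and [card_int_itv]
    counts them. *)
Lemma density_fp_near_le t r : 0 <= r -> density R (@fp_near R p t r) <= 2 * r + 1 / p%:R.
Proof.
move=> r0; rewrite /density card_Fp // ler_pdivrMr // mulrDl divfK ?gt_eqF //.
have /choice[e eP] : forall z : 'F_p, exists e : int,
    fp_near t r z -> `|(z : nat)%:R / p%:R - t - e%:~R| < r.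
  move=> z; have [[e ?]|?] := pselect (fp_near t r z); last by exists 0.
  by exists e.
have -> : 2 * r * p%:R = (t + r) * p%:R - (t - r) * p%:R by ring.
apply: (@card_int_itv R _ _ (fun z : 'F_p => (z : nat)%:Z - e z * p%:Z)).
- move=> x y _ _ exy; apply: val_inj => /=.
  have xp := leq_trans (ltn_ord x) (eq_leq (Fp_cast pp)).
  have yp := leq_trans (ltn_ord y) (eq_leq (Fp_cast pp)).
  have : (e x - e y) * p%:Z = (x : nat)%:Z - (y : nat)%:Z by rewrite mulrBl; lia.
  have [->|h] := eqVneq (e x) (e y); first by rewrite subrr mul0r; lia.
  have [|] := ltP (e x) (e y); nia.
- by rewrite ler_pM2r //; lra.
- move=> z; rewrite in_asbool => /asboolP/eP.
  rewrite ltr_norml rmorphB rmorphM /= => /andP[h1 h2].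
  rewrite -ltr_pdivlMr // -[X in _ && X]ltr_pdivrMr // mulrBl mulfK ?gt_eqF //.
  by apply/andP; split; lra.
Qed.
Variable I : finType.

(** The carrier of ['F_p] is the ordinal type displayed here, which has [p] elements for prime [p];
    the same function is thus read as a grid point and as a vector over the field. *)
Lemma bohr_Fp (C : finType) (L : C -> I -> int) (th r : C -> R) (k : {ffun I -> 'F_p}) :
  bohr L th r (grid_point R (k : {ffun I -> 'I_(Zp_trunc (pdiv p)).+2})) <->
  forall c, fp_near (th c) (r c) (\sum_i (L c i)%:~R * k i).
Proof.
have E c : \sum_i (L c i)%:~R * k i = (\sum_i L c i * (k i : nat)%:Z)%:~R :> 'F_p.
  by rewrite rmorph_sum /=; apply: eq_bigr => i _; rewrite rmorphM /= -pmulrn natr_Zp.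
have NE : ((Zp_trunc (pdiv p)).+2)%:R = p%:R :> R by rewrite Fp_cast.
have E' c : \sum_i (L c i)%:~R * grid_point R (k : {ffun I -> 'I_(Zp_trunc (pdiv p)).+2}) i
    = (\sum_i L c i * (k i : nat)%:Z)%:~R / p%:R.
  rewrite rmorph_sum /= mulr_suml; apply: eq_bigr => i _.
  by rewrite /grid_point NE mulrA rmorphM.
by split => H c; have := H c; rewrite E E' near_int_Fp.
Qed.

(** Adding [w / L i0] to the coordinate [i0] adds [w] to the value of the form, so all values are
    taken equally often. *)
Lemma density_form (L : I -> int) (P : 'F_p -> Prop) :
  (exists i, (L i)%:~R != 0 :> 'F_p) ->
  density R (fun k : {ffun I -> 'F_p} => P (\sum_i (L i)%:~R * k i)) = density R P.
Proof.
move=> [i0 Li0].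
have F0 : (0 < #|'F_p|)%N by rewrite card_Fp ?prime_gt0.
apply: (@density_equidistributed R _ _ (fun k : {ffun I -> 'F_p} => \sum_i (L i)%:~R * k i)
  (fun w k => [ffun i => k i + (w / (L i0)%:~R) *+ (i == i0)])
  (fun w x => x + w)) => //.
- by rewrite card_ffun expn_gt0 F0.
- move=> w k k' /ffunP kk; apply/ffunP => i.
  by have := kk i; rewrite !ffunE => /addIr.
- move=> w k; under eq_bigr do rewrite ffunE mulrDr.
  rewrite big_split /=; congr (_ + _); rewrite (bigD1 i0) //= eqxx mulr1n.
  rewrite big1 ?addr0; last by move=> i /negbTE ->; rewrite mulr0.
  by rewrite mulrCA divff // mulr1.
Qed.
End Fp.

Section Limit.
Variables (R : realType) (I C : finType).
Variables (L : C -> I -> int) (th r : C -> R) (A : set (I -> R)).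
Hypothesis I0 : (0 < #|I|)%N.
Hypothesis L0 : forall c, exists i, L c i != 0.
Hypothesis Aupper : A `<=` box (fun=> 0) (fun=> 1) `&` bohr L th r.
Hypothesis Alower : forall x, (forall i, 0 <= x i < 1) -> bohr L th r x -> A x.

Definition Fp_density (p : nat) (r' : C -> R) : R :=
  density R (fun k : {ffun I -> 'F_p} =>
    forall c, fp_near (th c) (r' c) (\sum_i (L c i)%:~R * k i)).

(** A point counted on the left only violates some reduced condition [c], so its form lies in one of
    two arcs of radius [2 * d]. By equidistribution each arc has density at most [4 * d + 1 / p]. *)
Lemma bohr_shell (p : nat) (d : R) : prime p -> 0 < d ->
  (forall c, exists i, (L c i)%:~R != 0 :> 'F_p) ->
  Fp_density p (fun c => r c + d) <=
  Fp_density p (fun c => r c - d) + \sum_(c : C) (2 * (4 * d + 1 / p%:R)).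
Proof.
move=> pp d0 Lp.
pose lin c (k : {ffun I -> 'F_p}) := \sum_i (L c i)%:~R * k i.
pose shell c (k : {ffun I -> 'F_p}) :=
  fp_near (th c + r c) (2 * d) (lin c k) \/ fp_near (th c - r c) (2 * d) (lin c k).
have shellP c : density R (shell c) <= 2 * (4 * d + 1 / p%:R).
  have d2 : 0 <= 2 * d by rewrite mulr_ge0 // ltW.
  apply: le_trans (density_or _ _ _) _.
  rewrite !(@density_form R p pp I (L c) (fun z => fp_near _ _ z)) //.
  have := density_fp_near_le pp (th c + r c) d2.
  have := density_fp_near_le pp (th c - r c) d2.
  lra.
apply: le_trans (lerD (lexx _) (ler_sum _ (fun c _ => shellP c))).
apply: le_trans (lerD (lexx _) (density_exists _ shell)).
apply: le_trans (density_or _ _ _); apply: le_density => k kP.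
have [?|nk] := pselect (forall c, fp_near (th c) (r c - d) (lin c k)); first by left.
right; have [c nc] : exists c, ~ fp_near (th c) (r c - d) (lin c k).
  by apply/existsNP.
exists c; have := near_int_shell d0 (kP c) nc.
by rewrite /shell /fp_near !opprD !addrA !opprK.
Qed.

(** Grid cells of side [1 / p] perturb every form by at most [d = La / p]. Both [leb A] and the
    density at radius [r] lie between the densities at [r - d] and [r + d], whose difference is at
    most [K / p] by the shell bound. *)
Lemma Fp_density_cvg : Fp_density p r @[p --> primes_oo] --> leb A.
Proof.
(* The summand 1 makes [d] positive. Moreover [La < p] ensures that [p] divides no nonzero
   coefficient. *)
pose La : R := 1 + \sum_c \sum_i `|L c i|%:~R.
have Lge0 c : 0 <= \sum_i `|L c i|%:~R :> R by apply: sumr_ge0 => i _; rewrite ler0z.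
have La1 : 1 <= La by rewrite lerDl sumr_ge0.
have Lle c : \sum_i `|L c i|%:~R <= La.
  rewrite /La (bigD1 c) //= addrCA lerDl addr_ge0 // sumr_ge0 // => c' _.
pose K : R := \sum_(c : C) (2 * (4 * La + 1)).
have K0 : 0 <= K by apply: sumr_ge0 => c _; lra.
have main p : prime p -> La < p%:R -> `|leb A - Fp_density p r| <= K / p%:R.
  move=> pp Lp; have p0 : 0 < p%:R :> R by rewrite ltr0n prime_gt0.
  pose d := La / p%:R; have d0 : 0 < d by rewrite divr_gt0 //; lra.
  have NE : ((Zp_trunc (pdiv p)).+2)%:R = p%:R :> R by rewrite Fp_cast.
  have Lpc c : exists i, (L c i)%:~R != 0 :> 'F_p.
    have [i Li] := L0 c; exists i; rewrite Fp_int_eq0 // gtnNdvd //.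
      by rewrite lt0n absz_eq0.
    rewrite -(ltr_nat R); apply: le_lt_trans Lp; apply: le_trans (Lle c).
    rewrite (bigD1 i) //= -[X in X <= _]/((`|L c i|%N)%:~R) abszE lerDl.
    by apply: sumr_ge0 => j _; rewrite ler0z.
  have Ld c : (\sum_i `|L c i|%:~R) / ((Zp_trunc (pdiv p)).+2)%:R <= d.
    by rewrite NE ler_pM2r ?invr_gt0.
  have := leb_grid I0 Aupper Alower (N := (Zp_trunc (pdiv p)).+2) isT Ld.
  have E s : density R (fun k : {ffun I -> 'I_(Zp_trunc (pdiv p)).+2} =>
      bohr L th s (grid_point R k)) = Fp_density p s.
    by apply: eq_density => k; exact: bohr_Fp.
  rewrite !E => /andP[le1 le2].
  have le3 := bohr_shell pp d0 Lpc.
  have le4 : Fp_density p (fun c => r c - d) <= Fp_density p r.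
    apply: le_density => k H c; apply: near_int_le (H c); lra.
  have le5 : Fp_density p r <= Fp_density p (fun c => r c + d).
    apply: le_density => k H c; apply: near_int_le (H c); lra.
  have KE : \sum_(c : C) (2 * (4 * d + 1 / p%:R)) = K / p%:R.
    by rewrite mulr_suml; apply: eq_bigr => c _; rewrite /d; field; rewrite gt_eqF.
  by rewrite ler_norml; lra.
apply/cvgrPdist_le => e e0; apply: (near_primes (N := Num.truncn (La + K / e))) => p pp.
rewrite -(ler_nat R) => /(lt_le_trans (truncnS_gt _)) hp.
have Ke : 0 <= K / e by rewrite divr_ge0 // ltW.
apply: le_trans (main p pp _) _; first by lra.
have p0 : 0 < p%:R :> R by rewrite ltr0n prime_gt0.
by rewrite ler_pdivrMr // mulrC -ler_pdivrMr //; lra.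
Qed.
End Limit.

(** * Shrinking two simultaneous approximation conditions *)

Section Shrink.
Variable R : realType.

Definition near_int2 (N : nat) (a1 a2 : int) (c1 c2 r1 r2 : R) (y : 'I_N) : Prop :=
  near_int r1 ((a1 * (y : nat)%:Z)%:~R / N%:R - c1) /\
  near_int r2 ((a2 * (y : nat)%:Z)%:~R / N%:R - c2).

(** With deviations [u] at [x] and [v] at [y], the new deviation is [u + L * (v - u) + a * l / N];
    the three terms are at most [r / 4], [r / 2] and [r / 4], and the bound on [u] is strict. *)
Lemma stretch_bound (a x y l L c i N s r : R) : 0 < N -> 0 < r -> 0 <= l -> l <= L -> 1 <= L ->
  L * s <= 1 / 4 -> 4 * `|a| * L <= r * N ->
  `|a * x / N - c - i| < s * r -> `|a * y / N - c - i| < s * r ->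
  `|a * (x + L * (y - x) + l) / N - c - i| < r.
Proof.
move=> N0 r0 l0 lL L1 Ls aN xs ys.
have s4 : s <= 1 / 4.
  have s0 : 0 < s by have := le_lt_trans (normr_ge0 _) xs; rewrite pmulr_lgt0.
  by apply: le_trans Ls; rewrite ler_peMl // ltW.
set u := a * x / N - c - i in xs; set v := a * y / N - c - i in ys.
have -> : a * (x + L * (y - x) + l) / N - c - i = u + L * (v - u) + a * l / N.
  by rewrite /u /v; ring.
have al : `|a * l / N| <= r / 4.
  rewrite normrM normfV (gtr0_norm N0) ler_pdivrMr // normrM (ger0_norm l0).
  have : `|a| * l <= `|a| * L by rewrite ler_wpM2l.
  lra.
have Lvu : `|L * (v - u)| <= r / 2.
  rewrite normrM ger0_norm; last lra.
  have h : `|v - u| <= 2 * (s * r) by apply: le_trans (ler_normB _ _) _; lra.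
  have : L * `|v - u| <= L * (2 * (s * r)) by rewrite ler_wpM2l //; lra.
  have : L * s * r <= 1 / 4 * r by rewrite ler_wpM2r // ltW.
  lra.
have sr : s * r <= 1 / 4 * r by rewrite ler_wpM2r // ltW.
apply: le_lt_trans (ler_normD _ _) _.
have := ler_normD u (L * (v - u)); lra.
Qed.

Lemma near_int_unique (r x : R) (i j : int) : r <= 1 / 2 ->
  `|x - i%:~R| < r -> `|x - j%:~R| < r -> i = j.
Proof.
move=> r2 xi xj; have : `|(i - j)%:~R : R| < 1%:~R.
  have -> : (i - j)%:~R = (x - j%:~R) - (x - i%:~R) :> R by rewrite intrB; ring.
  apply: le_lt_trans (ler_normB _ _) _; lra.
by rewrite -intr_norm ltr_int; lia.
Qed.

Lemma norm_intr_ge1 (a : int) : a != 0 -> 1 <= `|a%:~R| :> R.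
Proof. by move=> a0; rewrite -intr_norm ler1z -gtz0_ge1 normr_gt0. Qed.

(** After cancelling [b], this is uniqueness of quotient and remainder modulo [L]. *)
Lemma euclid_unique (L y y' l l' : nat) (b : int) : (l < L)%N -> (l' < L)%N ->
  b + L%:Z * (y%:Z - b) + l%:Z = b + L%:Z * (y'%:Z - b) + l'%:Z -> y = y' /\ l = l'.
Proof.
move=> lL l'L h.
have yy : L%:Z * (y%:Z - y'%:Z) = l'%:Z - l%:Z by lia.
have yy' : y = y' by have [//|hlt|hlt] := ltngtP y y'; nia.
by rewrite yy' subrr mulr0 in yy; lia.
Qed.

Lemma absz_shift (x : int) (N : nat) : - N%:Z <= x < 2 * N%:Z ->
  (absz (x + N%:Z))%:Z = x + N%:Z /\ (absz (x + N%:Z)%R < 3 * N)%N.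
Proof. by lia. Qed.

Lemma modz_shift (x : int) (w N : nat) : w%:Z = x + N%:Z ->
  ((w %% N)%N%:Z : int) = x + (1 - (w %/ N)%N%:Z) * N%:Z.
Proof. by move=> h; have := divn_eq w N; lia. Qed.

(* Two points [b], [y] of the same component of the shrunken set give, for
   [L <= 1 / (4 s)], the points [b + L (y - b) + l], [l < L], of the same
   component of the larger set; the interval around a component has length at
   most [N], which accounts for the factor 3. *)
Lemma near_int2_shrink_card (N L : nat) (a1 a2 : int) (c1 c2 r1 r2 s : R) :
  (0 < N)%N -> (0 < L)%N -> a1 != 0 -> 0 < r1 <= 1 / 2 -> 0 < r2 <= 1 / 2 ->
  L%:R * s <= 1 / 4 -> 2 * L%:R <= N%:R :> R ->
  4 * `|a1%:~R| * L%:R <= r1 * N%:R -> 4 * `|a2%:~R| * L%:R <= r2 * N%:R ->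
  (#|[set y : 'I_N | `[< near_int2 a1 a2 c1 c2 (s * r1) (s * r2) y >]]%SET| * L <=
   3 * #|[set y : 'I_N | `[< near_int2 a1 a2 c1 c2 r1 r2 y >]]%SET|)%N.
Proof.
move=> N0 L0 a10 /andP[r10 r12] /andP[r20 r22] Ls LN aN1 aN2.
have N0R : 0 < N%:R :> R by rewrite ltr0n.
have L1R : 1 <= L%:R :> R by rewrite ler1n.
set Ss := [set y | _]%SET; set S1 := [set y | _]%SET.
pose lift1 (y : 'I_N) (ij : int * int) :=
  `|a1%:~R * (y : nat)%:R / N%:R - c1 - ij.1%:~R| < s * r1 /\
  `|a2%:~R * (y : nat)%:R / N%:R - c2 - ij.2%:~R| < s * r2.
(* The pair [e y] of integers near the two forms labels the component of the shrunken set that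
   contains [y]. *)
have /choice[e eP] : forall y : 'I_N, exists ij, y \in Ss -> lift1 y ij.
  move=> y; case: (boolP (y \in Ss)) => [|_]; last by exists (0, 0).
  rewrite in_asbool => /asboolP[[i hi] [j hj]]; exists (i, j) => _.
  by move: hi hj; rewrite !rmorphM.
(* One base point per component; an empty component gets the default 0. *)
have /choice[b bP] : forall ij, exists y0 : 'I_N,
    forall y, y \in Ss -> e y = ij -> lift1 y0 ij.
  move=> ij; have [[y [yS yij]]|h] := pselect (exists y, y \in Ss /\ e y = ij).
    by exists y => _ _ _; rewrite -yij; exact: eP.
  by exists (Ordinal N0) => y yS yij; exfalso; apply: h; exists y.
pose z (yl : 'I_N * 'I_L) : int := let b0 := (b (e yl.1) : nat)%:Z in
  b0 + L%:Z * ((yl.1 : nat)%:Z - b0) + (yl.2 : nat)%:Z.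
have zE yl : (z yl)%:~R = (b (e yl.1) : nat)%:R +
    L%:R * ((yl.1 : nat)%:R - (b (e yl.1) : nat)%:R) + (yl.2 : nat)%:R :> R.
  by rewrite /z !rmorphD rmorphM rmorphB.
have zin yl : yl.1 \in Ss ->
   `|a1%:~R * (z yl)%:~R / N%:R - c1 - (e yl.1).1%:~R| < r1 /\
   `|a2%:~R * (z yl)%:~R / N%:R - c2 - (e yl.1).2%:~R| < r2.
  move=> yS; have [h1 h2] := eP _ yS; have [h3 h4] := bP _ _ yS erefl.
  have lL : (yl.2 : nat)%:R <= L%:R :> R by rewrite ler_nat ltnW.
  by rewrite zE; split; apply: (@stretch_bound _ _ _ _ _ _ _ _ s).
(* As [|a1| >= 1] and [r1 <= 1 / 2], two points of a component differ by at most [s * N]. Stretching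
   thus moves a point by at most [N / 4] from the base point, and [l] adds less than [N / 2]. *)
have zrange yl : yl.1 \in Ss -> - N%:Z <= z yl < 2 * N%:Z.
  move=> yS; have [h1 _] := eP _ yS; have [h3 _] := bP _ _ yS erefl.
  have s0 : 0 < s by have := le_lt_trans (normr_ge0 _) h1; rewrite pmulr_lgt0.
  have yb : `|(yl.1 : nat)%:R - (b (e yl.1) : nat)%:R| <= s * N%:R :> R.
    have a1R := norm_intr_ge1 a10.
    have : `|a1%:~R * ((yl.1 : nat)%:R - (b (e yl.1) : nat)%:R) / N%:R| <= s :> R.
      rewrite (_ : _ / _ = (a1%:~R * (yl.1 : nat)%:R / N%:R - c1 - (e yl.1).1%:~R) -
        (a1%:~R * (b (e yl.1) : nat)%:R / N%:R - c1 - (e yl.1).1%:~R)); last by ring.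
      apply: le_trans (ler_normB _ _) _.
      have : s * r1 <= s * (1 / 2) by rewrite ler_wpM2l // ltW.
      lra.
    rewrite !normrM normfV (gtr0_norm N0R) ler_pdivrMr //; apply: le_trans.
    by rewrite ler_peMl.
  have LyB : L%:R * `|(yl.1 : nat)%:R - (b (e yl.1) : nat)%:R| <= 1 / 4 * N%:R :> R.
    have : L%:R * `|(yl.1 : nat)%:R - (b (e yl.1) : nat)%:R| <= L%:R * (s * N%:R) :> R.
      by rewrite ler_wpM2l.
    have : L%:R * s * N%:R <= 1 / 4 * N%:R by rewrite ler_wpM2r.
    lra.
  have bN : (b (e yl.1) : nat)%:R < N%:R :> R by rewrite ltr_nat.
  have b0 : 0 <= (b (e yl.1) : nat)%:R :> R by rewrite ler0n.
  have lL : (yl.2 : nat)%:R < L%:R :> R by rewrite ltr_nat.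
  have l0 : 0 <= (yl.2 : nat)%:R :> R by rewrite ler0n.
  have := zE yl; move: LyB; rewrite -[X in X * `|_|](ger0_norm (ler0n R L)) -normrM.
  rewrite ler_norml => /andP[h5 h6] zy.
  rewrite -(ler_int R) -(ltr_int R) rmorphN rmorphM /= zy.
  by apply/andP; split; lra.
pose w yl := absz (z yl + N%:Z).
have wP yl : yl.1 \in Ss -> (w yl)%:Z = z yl + N%:Z /\ (w yl < 3 * N)%N.
  by move=> /zrange /absz_shift.
have wdiv yl : yl.1 \in Ss -> (w yl %/ N < 3)%N by move=> /wP[_ ?]; rewrite ltn_divLR.
(* The remainder modulo [N] lands in the larger set; the quotient, one of three values, keeps the
   map injective. *)
pose h yl : 'I_3 * 'I_N := (inord (w yl %/ N), Ordinal (ltn_pmod (w yl) N0)).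
have inSx (yl : 'I_N * 'I_L) : (yl \in finset.setX Ss [set: 'I_L]%SET) = (yl.1 \in Ss).
  by case: yl => y l; rewrite finset.in_setX finset.in_setT andbT.
(* The image determines [z]. Since the larger radii are at most 1/2, [z] determines the nearest
   integers, hence the component and its base point; Euclidean division then recovers [y] and
   [l]. *)
have hinj : {in finset.setX Ss [set: 'I_L]%SET &, injective h}.
  move=> yl yl'; rewrite !inSx => yS yS' [] /(congr1 val).
  rewrite /= !inordK ?wdiv // => hd hm.
  have ww : w yl = w yl' by rewrite (divn_eq (w yl) N) hd hm -divn_eq.
  have zz : z yl = z yl'.
    have [h1 _] := wP _ yS; have [h2 _] := wP _ yS'.
    by apply: (addIr N%:Z); rewrite -h1 -h2 ww.
  have [u1 u2] := zin _ yS; have [u1' u2'] := zin _ yS'.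
  rewrite -zz in u1' u2'.
  have ee : e yl.1 = e yl'.1.
    have := near_int_unique r12 u1 u1'; have := near_int_unique r22 u2 u2'.
    by move: (e yl.1) (e yl'.1) => [? ?] [? ?] /= -> ->.
  move: zz; rewrite /z ee; case: yl yl' {ww hd hm u1 u2 u1' u2' ee yS yS'} => [y l] [y' l'] /=.
  set b0 := (b _ : nat)%:Z => zz.
  have [yy ll] := euclid_unique (ltn_ord l) (ltn_ord l') zz.
  by congr pair; apply: val_inj.
have hS yl : yl \in finset.setX Ss [set: 'I_L]%SET -> h yl \in finset.setX [set: 'I_3]%SET S1.
  rewrite inSx => yS; rewrite finset.in_setX finset.in_setT /= in_asbool; apply/asboolP.
  have [u1 u2] := zin _ yS; have [wz _] := wP _ yS.
  have mE := modz_shift wz.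
  have aux (a : int) (c r : R) (i : int) : `|a%:~R * (z yl)%:~R / N%:R - c - i%:~R| < r ->
      near_int r ((a * (w yl %% N)%N%:Z)%:~R / N%:R - c).
    move=> u; rewrite mE.
    have -> : (a * (z yl + (1 - (w yl %/ N)%N%:Z) * N%:Z))%:~R / N%:R - c =
       a%:~R * (z yl)%:~R / N%:R - c + (a * (1 - (w yl %/ N)%N%:Z))%:~R :> R.
      by rewrite !(rmorphM, rmorphD) /=; field; rewrite gt_eqF.
    by apply/near_int_add; exists i.
  by split; [exact: aux u1 | exact: aux u2].
have := subset_leq_card (_ : h @: finset.setX Ss [set: 'I_L]%SET \subset finset.setX [set: 'I_3]%SET S1).
rewrite card_in_imset // !cardsX !cardsT !card_ord; apply.
by apply/fintype.subsetP => x /imsetP[yl /hS ? ->].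
Qed.
End Shrink.

Lemma dvdn_shift_inj (p l l' : nat) (f : int) : (l < p)%N -> (l' < p)%N ->
  (p %| absz ((f + l%:Z) - (f + l'%:Z))%R)%N -> l = l'.
Proof.
rewrite opprD addrACA subrr add0r => lp l'p h.
have [d0|d0] := posnP (absz (l%:Z - l'%:Z)%R); first by lia.
by have := dvdn_leq d0 h; lia.
Qed.

Section OneDim.
Variable R : realType.
Implicit Types (c r s t : R).

(** The constant 24 is 3 from the wrap-around count times 8 from [1 <= 8 * s * L], where [L] is the
    integer part of [1 / (4 * s)]. If [L = 0] then [s > 1 / 4], and monotonicity suffices. *)
Lemma near_int2_shrink (a1 a2 : int) c1 c2 r1 r2 s :
  a1 != 0 -> 0 < r1 <= 1 / 2 -> 0 < r2 <= 1 / 2 -> 0 < s <= 1 ->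
  exists N0, forall N, (N0 < N)%N ->
    density R (@near_int2 R N a1 a2 c1 c2 (s * r1) (s * r2)) <=
    24 * s * density R (@near_int2 R N a1 a2 c1 c2 r1 r2).
Proof.
move=> a10 /[dup] r1h /andP[r10 _] /[dup] r2h /andP[r20 _] /andP[s0 s1].
have dle N : density R (@near_int2 R N a1 a2 c1 c2 (s * r1) (s * r2)) <=
    density R (@near_int2 R N a1 a2 c1 c2 r1 r2).
  apply: le_density => y [h1 h2]; split.
    by apply: near_int_le h1; rewrite ler_piMl // ltW.
  by apply: near_int_le h2; rewrite ler_piMl // ltW.
pose L := Num.truncn (1 / (4 * s)).
have s40 : 0 < 4 * s by rewrite mulr_gt0.
have Lge : 1 / (4 * s) < L.+1%:R by exact: truncnS_gt.
have Lle : L%:R <= 1 / (4 * s) by rewrite truncn_le divr_ge0 // ltW.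
rewrite ltr_pdivrMr // in Lge; rewrite ler_pdivlMr // in Lle.
have [L0|L0] := posnP L.
  exists 0%N => N _; apply: le_trans (dle N) _.
  by rewrite ler_peMl ?density_ge0 //; move: Lge; rewrite L0; lra.
have s8 : 1 <= 8 * s * L%:R.
  have : L.+1%:R <= 2 * L%:R :> R by rewrite -natrM ler_nat; lia.
  move=> h; have : L.+1%:R * (4 * s) <= 2 * L%:R * (4 * s) by rewrite ler_pM2r.
  lra.
pose X1 := 4 * `|a1%:~R| * L%:R / r1; pose X2 := 4 * `|a2%:~R| * L%:R / r2.
have X10 : 0 <= X1 by rewrite divr_ge0 ?(ltW r10) // mulr_ge0 // mulr_ge0.
have X20 : 0 <= X2 by rewrite divr_ge0 ?(ltW r20) // mulr_ge0 // mulr_ge0.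
have LR : 0 <= L%:R :> R by rewrite ler0n.
exists (Num.truncn (X1 + X2 + 2 * L%:R)) => N.
rewrite -(ler_nat R) => /(lt_le_trans (truncnS_gt _)) NX.
have N0 : (0 < N)%N by rewrite -(ltr_nat R); lra.
have := @near_int2_shrink_card R N L a1 a2 c1 c2 r1 r2 s N0 L0 a10 r1h r2h.
have Ls : L%:R * s <= 1 / 4 by lra.
have LN : 2 * L%:R <= N%:R :> R by lra.
have aN1 : 4 * `|a1%:~R| * L%:R <= r1 * N%:R :> R.
  have : X1 <= N%:R by lra.
  by rewrite ler_pdivrMr // [_ * r1]mulrC.
have aN2 : 4 * `|a2%:~R| * L%:R <= r2 * N%:R :> R.
  have : X2 <= N%:R by lra.
  by rewrite ler_pdivrMr // [_ * r2]mulrC.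
move=> /(_ Ls LN aN1 aN2); rewrite /density.
set A := #|_|; set B := #|_|; rewrite -(ler_nat R) !natrM => AB.
rewrite mulrA ler_pM2r ?invr_gt0 ?card_ord ?ltr0n //.
have A0 : 0 <= A%:R :> R by rewrite ler0n.
have : A%:R * 1 <= A%:R * (8 * s * L%:R) by rewrite ler_wpM2l.
have : 8 * s * (A%:R * L%:R) <= 8 * s * (3 * B%:R) by rewrite ler_pM2l //; lra.
lra.
Qed.

Definition parallel_density (p : nat) (a1 a2 : int) c1 c2 r1 r2 : R :=
  density R (fun y : 'F_p => fp_near c1 r1 (a1%:~R * y) /\ fp_near c2 r2 (a2%:~R * y)).

Lemma parallel_densityE (p : nat) (a1 a2 : int) c1 c2 r1 r2 : prime p ->
  parallel_density p a1 a2 c1 c2 r1 r2 =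
  density R (@near_int2 R (Zp_trunc (pdiv p)).+2 a1 a2 c1 c2 r1 r2).
Proof.
have NE : prime p -> ((Zp_trunc (pdiv p)).+2)%:R = p%:R :> R by move=> pp; rewrite Fp_cast.
move=> pp; apply: eq_density => y; rewrite /near_int2 NE //.
have E (a : int) : a%:~R * y = (a * (y : nat)%:Z)%:~R :> 'F_p.
  by rewrite rmorphM /= -pmulrn natr_Zp.
by rewrite !E -!(near_int_Fp pp).
Qed.

(** A condition of radius above 1/2 always holds before shrinking. In that case the other condition
    is used twice, and the shrunken large one is dropped from the left-hand side. *)
Lemma parallel_shrink (a1 a2 : int) c1 c2 r1 r2 s :
  a1 != 0 -> a2 != 0 -> 0 < r1 -> 0 < r2 -> r1 <= 1 / 2 \/ r2 <= 1 / 2 -> 0 < s <= 1 ->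
  \forall p \near primes_oo, parallel_density p a1 a2 c1 c2 (s * r1) (s * r2) <=
    24 * s * parallel_density p a1 a2 c1 c2 r1 r2.
Proof.
move=> a10 a20 r10 r20 r12 sh.
have key b1 b2 d1 d2 u1 u2 : b1 != 0 -> 0 < u1 <= 1 / 2 -> 0 < u2 <= 1 / 2 ->
  exists N0, forall p, prime p -> (N0 < p)%N ->
    parallel_density p b1 b2 d1 d2 (s * u1) (s * u2) <=
    24 * s * parallel_density p b1 b2 d1 d2 u1 u2.
  move=> b10 u1h u2h; have [N0 h] := near_int2_shrink b2 d1 d2 b10 u1h u2h sh.
  by exists N0 => p pp N0p; rewrite !parallel_densityE //; apply: h; rewrite Fp_cast.
have s24 : 0 <= 24 * s by case/andP: sh => *; lra.
have [h1|h1] := lerP r1 (1 / 2); have [h2|h2] := lerP r2 (1 / 2).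
- have [||N0 h] := key a1 a2 c1 c2 r1 r2 a10; rewrite ?r10 ?r20 //.
  exact: near_primes h.
- have [||N0 h] := key a1 a1 c1 c1 r1 r1 a10; rewrite ?r10 //.
  apply: (near_primes (N := N0)) => p pp /(h p pp) hp.
  apply: le_trans (le_trans _ hp) _; first by apply: le_density => y [? _].
  apply: ler_wpM2l => //; apply: le_density => y [? _]; split => //.
  exact: near_int_big.
- have [||N0 h] := key a2 a2 c2 c2 r2 r2 a20; rewrite ?r20 //.
  apply: (near_primes (N := N0)) => p pp /(h p pp) hp.
  apply: le_trans (le_trans _ hp) _; first by apply: le_density => y [_ ?].
  apply: ler_wpM2l => //; apply: le_density => y [? _]; split => //.
  exact: near_int_big.
- by case: r12; lra.
Qed.

(** The residues of [floor (p * t) + l] with [l < truncn (p * r)] satisfy the condition and are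
    distinct as long as [l < p]. The hypothesis [2 <= p * r] gives [p * r - 1 >= p * r / 2], which
    covers the rounding loss. *)
Lemma density_fp_near_ge (p : nat) t r : prime p -> 2 <= p%:R * r ->
  Num.min 1 r / 2 <= density R (@fp_near R p t r).
Proof.
move=> pp pr; have p0 : 0 < p%:R :> R by rewrite ltr0n prime_gt0.
have r0 : 0 < r by rewrite -(pmulr_rgt0 _ p0); lra.
pose K := minn p (Num.truncn (p%:R * r)).
pose f := Num.floor (p%:R * t).
pose z (l : 'I_K) : 'F_p := (f + (l : nat)%:Z)%:~R.
have zinj : injective z.
  move=> l l' /eqP; rewrite -subr_eq0 -rmorphB /= Fp_int_eq0 // => pl.
  have lp : (l < p)%N := leq_trans (ltn_ord l) (geq_minl _ _).
  have lp' : (l' < p)%N := leq_trans (ltn_ord l') (geq_minl _ _).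
  by apply: val_inj; exact: dvdn_shift_inj pl.
have zP l : fp_near t r (z l).
  apply/(near_int_Fp pp); exists 0; rewrite subr0.
  have : (l < Num.truncn (p%:R * r))%N := leq_trans (ltn_ord l) (geq_minr _ _).
  rewrite truncn_gt_nat => lr.
  have /andP[f1 f2] := floor_itv (p%:R * t).
  rewrite -(ltr_pM2l p0) -[X in X * _](ger0_norm (ltW p0)) -normrM.
  rewrite mulrBr mulrCA divff ?gt_eqF // mulr1 rmorphD /=.
  rewrite -addn1 natrD in lr; rewrite intrD -/f in f2; rewrite -/f in f1.
  have l0 : 0 <= (l : nat)%:R :> R by rewrite ler0n.
  by rewrite ltr_norml -pmulrn; apply/andP; split; lra.
rewrite /density card_Fp // ler_pdivlMr //.
apply: (@le_trans _ _ K%:R).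
  rewrite /K; have h : p%:R * r < (Num.truncn (p%:R * r)).+1%:R by exact: truncnS_gt.
  rewrite -addn1 natrD in h.
  have m1 : Num.min 1 r <= 1 by rewrite ge_min lexx.
  have m2 : Num.min 1 r <= r by rewrite ge_min lexx orbT.
  have : Num.min 1 r * p%:R <= 1 * p%:R by rewrite ler_pM2r.
  have : Num.min 1 r * p%:R <= r * p%:R by rewrite ler_pM2r.
  by rewrite /minn; case: ifP => _; lra.
rewrite ler_nat -[X in (X <= _)%N](card_ord K) -(card_imset _ zinj).
apply: subset_leq_card; apply/fintype.subsetP => x /imsetP[l _ ->].
by rewrite in_asbool; apply/asboolP.
Qed.
End OneDim.

(** * Measures of the sets A(q, B) and of their intersections *)

Section Columns.
Variables (R : realType) (n m p : nat).
Hypothesis pp : prime p.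

(** The section [g] makes [lin] surjective: adding [g (w j)] to column [j] translates the vector of
    values by [w]. These values are therefore equidistributed, and the columns are independent. *)
Lemma density_columns (U : finType) (add : U -> U -> U) (lin : ('I_n -> 'F_p) -> U)
    (g : U -> 'I_n -> 'F_p) (P : 'I_m -> U -> Prop) :
  (forall x y, lin (fun i => x i + y i) = add (lin x) (lin y)) ->
  (forall u, injective (add u)) -> (forall u, lin (g u) = u) ->
  density R (fun k : {ffun 'I_n * 'I_m -> 'F_p} => forall j, P j (lin (fun i => k (i, j))))
  = \prod_j density R (P j).
Proof.
move=> linD addI gK; rewrite -density_ffun.
have U0 : (0 < #|U|)%N by apply/card_gt0P; exists (lin (fun=> 0)).
have F0 : (0 < #|'F_p|)%N by rewrite card_Fp ?prime_gt0.
pose f (k : {ffun 'I_n * 'I_m -> 'F_p}) : {ffun 'I_m -> U} := [ffun j => lin (fun i => k (i, j))].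
have -> : density R (fun k : {ffun 'I_n * 'I_m -> 'F_p} => forall j, P j (lin (fun i => k (i, j))))
   = density R (fun k => forall j, P j (f k j)).
  by apply: eq_density => k; split => H j; have := H j; rewrite ffunE.
apply: (@density_equidistributed R _ _ f
  (fun w k => [ffun ij => k ij + g (w ij.2) ij.1]) (fun w x => [ffun j => add (x j) (w j)])
  (fun x : {ffun 'I_m -> U} => forall j, P j (x j))).
- by rewrite card_ffun expn_gt0 F0.
- by rewrite card_ffun expn_gt0 U0.
- move=> w k k' /ffunP kk; apply/ffunP => ij.
  by have := kk ij; rewrite !ffunE => /addIr.
- move=> w k; apply/ffunP => j; rewrite !ffunE -[X in add _ X]gK -linD.
  by congr lin; apply/funext => i; rewrite ffunE.
- move=> u x y /= /ffunP xy; apply/ffunP => j.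
  by have := xy j; rewrite !ffunE => /addI.
Qed.
End Columns.

Section Balls.
Variables (R : realType) (m : nat).
Implicit Types B : tball R m.

Lemma in_tballE B y : in_tball B y <-> forall j, near_int (bradius B) (y j - bcentre B j).
Proof.
split => [[p yp] j|/choice[p yp]]; first by exists (p j); exact: yp.
by exists p.
Qed.

(** The integer vector in [Aset] is absorbed by the one already present in [in_tball]. *)
Lemma AsetE n (q : 'I_n -> int) B x : Aset q B x <->
  (forall ij, 0 <= x ij <= 1) /\ forall j, near_int (bradius B) (qmul q x j - bcentre B j).
Proof.
split => -[x01]; last first.
  move=> H; split => //; exists (fun=> 0); apply/in_tballE => j; rewrite addr0; exact: H.
move=> [p /in_tballE H]; split => // j; have := H j.
by rewrite addrAC => /near_int_add.
Qed.

Definition pair_density n (q1 q2 : 'I_n -> int) B1 B2 (p : nat) : R :=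
  density R (fun k : {ffun 'I_n * 'I_m -> 'F_p} => forall j,
    fp_near (bcentre B1 j) (bradius B1) (\sum_i (q1 i)%:~R * k (i, j)) /\
    fp_near (bcentre B2 j) (bradius B2) (\sum_i (q2 i)%:~R * k (i, j))).

Lemma sum_column (K : nzRingType) n (j : 'I_m) (a : 'I_n -> int) (x : 'I_n * 'I_m -> K) :
  \sum_(ij : 'I_n * 'I_m) (if ij.2 == j then a ij.1 else 0)%:~R * x ij =
  \sum_i (a i)%:~R * x (i, j).
Proof.
rewrite (eq_bigr (fun ij => (if ij.2 == j then a ij.1 else 0)%:~R * x (ij.1, ij.2))); last by case.
rewrite -(pair_bigA _ (fun i j' => (if j' == j then a i else 0)%:~R * x (i, j'))) /=.
apply: eq_bigr => i _; rewrite (bigD1 j) //= eqxx big1 ?addr0 // => j' /negbTE ->.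
by rewrite mul0r.
Qed.

(** The intersection is a Bohr set for [2 * m] forms in the matrix entries: the boolean selects the
    vector, the other index the column. *)
Lemma Aset_pair_cvg n (q1 q2 : 'I_n -> int) B1 B2 : (0 < m)%N ->
  (exists i, q1 i != 0) -> (exists i, q2 i != 0) ->
  pair_density q1 q2 B1 B2 p @[p --> primes_oo] --> leb (Aset q1 B1 `&` Aset q2 B2).
Proof.
move=> m0 q10 q20.
pose L (bj : bool * 'I_m) (ij : 'I_n * 'I_m) : int :=
  if ij.2 == bj.2 then (if bj.1 then q1 else q2) ij.1 else 0.
pose th (bj : bool * 'I_m) := bcentre (if bj.1 then B1 else B2) bj.2.
pose r (bj : bool * 'I_m) := bradius (if bj.1 then B1 else B2).
have I0 : (0 < #|{: 'I_n * 'I_m}|)%N.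
  by have [i _] := q10; apply/card_gt0P; exists (i, Ordinal m0).
have L0 bj : exists ij, L bj ij != 0.
  have [i qi] : exists i, (if bj.1 then q1 else q2) i != 0 by case: ifP.
  by exists (i, bj.2); rewrite /L eqxx.
have BE x : bohr L th r x <-> (forall j, near_int (bradius B1) (qmul q1 x j - bcentre B1 j)) /\
    (forall j, near_int (bradius B2) (qmul q2 x j - bcentre B2 j)).
  split=> [H|[H1 H2] [[] j]]; last 2 first.
  - rewrite /= sum_column; exact: H1.
  - rewrite /= sum_column; exact: H2.
  split=> j; first by have := H (true, j); rewrite /= sum_column.
  by have := H (false, j); rewrite /= sum_column.
have -> : (fun p => pair_density q1 q2 B1 B2 p) = (fun p => Fp_density L th p r).
  apply/funext => p; apply: eq_density => k; split=> [H [[] j]|H j].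
  - by rewrite sum_column; case: (H j).
  - by rewrite sum_column; case: (H j).
  by have := H (true, j); have := H (false, j); rewrite !sum_column.
apply: Fp_density_cvg => //.
- move=> x [/AsetE[x01 h1] /AsetE[_ h2]]; split; first by move=> ij; exact: x01.
  exact/BE.
- move=> x x01 /BE[h1 h2].
  have x01' ij : 0 <= x ij <= 1 by have /andP[-> /ltW] := x01 ij.
  by split; apply/AsetE.
Qed.

Lemma tball_meas_cvg B : (0 < m)%N ->
  \prod_j density R (@fp_near R p (bcentre B j) (bradius B)) @[p --> primes_oo]
    --> tball_meas B.
Proof.
move=> m0; pose L (j i : 'I_m) : int := (i == j)%:Z.
have LE (K : nzRingType) (j : 'I_m) (x : 'I_m -> K) : \sum_i (L j i)%:~R * x i = x j.
  rewrite (bigD1 j) //= /L eqxx mul1r big1 ?addr0 // => i /negbTE ->.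
  by rewrite mul0r.
have -> : (fun p => \prod_j density R (@fp_near R p (bcentre B j) (bradius B))) =
    (fun p => Fp_density L (bcentre B) p (fun=> bradius B)).
  apply/funext => p; rewrite -density_ffun; apply: eq_density => k.
  by split => H j; have := H j; rewrite LE.
apply: Fp_density_cvg => //.
- by rewrite card_ord.
- by move=> j; exists j; rewrite /L eqxx.
- move=> y [y01 /in_tballE yB]; split; first by move=> j; have /andP[-> /ltW] := y01 j.
  by move=> j; rewrite LE.
- move=> y y01 yB; split => //; apply/in_tballE => j; have := yB j; by rewrite LE.
Qed.

(** A nonzero minor [D] stays invertible modulo every prime above [|D|], so the two forms map onto
    the plane over ['F_p]. The section [g] is Cramer's rule. *)
Lemma pair_density_nonparallel n (q1 q2 : 'I_n -> int) B1 B2 i j :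
  q1 i * q2 j != q1 j * q2 i ->
  \forall p \near primes_oo, pair_density q1 q2 B1 B2 p =
    \prod_j density R (@fp_near R p (bcentre B1 j) (bradius B1)) *
    \prod_j density R (@fp_near R p (bcentre B2 j) (bradius B2)).
Proof.
rewrite -subr_eq0 => D0; set D := _ - _ in D0.
apply: (near_primes (N := absz D)) => p pp Dp.
have Dp0 : D%:~R != 0 :> 'F_p by rewrite Fp_int_eq0 // gtnNdvd // lt0n absz_eq0.
pose lin (x : 'I_n -> 'F_p) : 'F_p * 'F_p := (\sum_i (q1 i)%:~R * x i, \sum_i (q2 i)%:~R * x i).
pose g (u : 'F_p * 'F_p) (l : 'I_n) : 'F_p :=
  (u.1 * (q2 j)%:~R - u.2 * (q1 j)%:~R) / D%:~R *+ (l == i) +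
  (u.2 * (q1 i)%:~R - u.1 * (q2 i)%:~R) / D%:~R *+ (l == j).
have sg (a : 'I_n -> 'F_p) X (l0 : 'I_n) : \sum_l a l * (X *+ (l == l0)) = a l0 * X.
  rewrite (bigD1 l0) //= eqxx big1 ?addr0 // => l /negbTE ->.
  by rewrite mulr0.
have := @density_columns R n m p pp ('F_p * 'F_p)%type +%R lin g (fun j u =>
  fp_near (bcentre B1 j) (bradius B1) u.1 /\ fp_near (bcentre B2 j) (bradius B2) u.2).
rewrite -big_split /=; under [X in _ -> _ -> _ = X]eq_bigr do rewrite density_pair.
apply.
- move=> x y; rewrite /lin; congr pair; rewrite -big_split; apply: eq_bigr => l _; exact: mulrDr.
- by move=> u x y /addrI.
- move=> [u v]; rewrite /lin /g /=; congr pair.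
    under eq_bigr do rewrite mulrDr; rewrite big_split !sg /=.
    by move: Dp0; rewrite /D rmorphB !rmorphM /= => ?; field.
  under eq_bigr do rewrite mulrDr; rewrite big_split !sg /=.
  by move: Dp0; rewrite /D rmorphB !rmorphM /= => ?; field.
Qed.

(** Both forms are multiples, by [a1] and [a2], of the single form [lin], which is onto. Hence the
    density depends on [q1] and [q2] only through [a1] and [a2], and not on [n]. *)
Lemma pair_density_parallel n (q1 q2 : 'I_n -> int) B1 B2 (a1 a2 : int) :
  (exists i, q1 i != 0) -> a1 != 0 -> (forall i, a1 * q2 i = a2 * q1 i) ->
  \forall p \near primes_oo, pair_density q1 q2 B1 B2 p =
    \prod_j parallel_density p a1 a2 (bcentre B1 j) (bcentre B2 j) (bradius B1) (bradius B2).
Proof.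
move=> [i qi0] a10 par; apply: (near_primes (N := (absz a1 + absz (q1 i))%N)) => p pp hp.
have a1p : a1%:~R != 0 :> 'F_p.
  by rewrite Fp_int_eq0 // gtnNdvd ?lt0n ?absz_eq0 //; apply: leq_ltn_trans hp; exact: leq_addr.
have qip : (q1 i)%:~R != 0 :> 'F_p.
  by rewrite Fp_int_eq0 // gtnNdvd ?lt0n ?absz_eq0 //; apply: leq_ltn_trans hp; exact: leq_addl.
pose lin (x : 'I_n -> 'F_p) : 'F_p := (\sum_i (q1 i)%:~R * x i) / a1%:~R.
pose g (u : 'F_p) (l : 'I_n) : 'F_p := (u * a1%:~R / (q1 i)%:~R) *+ (l == i).
rewrite -(@density_columns R n m p pp 'F_p +%R lin g (fun j u =>
  fp_near (bcentre B1 j) (bradius B1) (a1%:~R * u) /\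
  fp_near (bcentre B2 j) (bradius B2) (a2%:~R * u))).
- apply: eq_density => k.
  have E1 j : a1%:~R * lin (fun i => k (i, j)) = \sum_i (q1 i)%:~R * k (i, j).
    by rewrite /lin mulrCA divff // mulr1.
  have E2 j : a2%:~R * lin (fun i => k (i, j)) = \sum_i (q2 i)%:~R * k (i, j).
    rewrite /lin mulrA mulr_sumr mulr_suml; apply: eq_bigr => l _.
    have parF : a2%:~R * (q1 l)%:~R = a1%:~R * (q2 l)%:~R :> 'F_p by rewrite -!rmorphM par.
    by rewrite [a2%:~R * _]mulrA parF; field.
  by split=> H j; have := H j; rewrite E1 E2.
- move=> x y; rewrite /lin -mulrDl -big_split; congr (_ / _).
  by apply: eq_bigr => l _; exact: mulrDr.
- by move=> u x y /addrI.
- move=> u; rewrite /lin /g (bigD1 i) //= eqxx big1 ?addr0; last first.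
    by move=> l /negbTE ->; rewrite mulr0.
  by rewrite mulr1n mulrCA divff // mulr1 mulfK.
Qed.

End Balls.

Section Measures.
Variables (R : realType) (m : nat).
Hypothesis m0 : (0 < m)%N.
Implicit Types B : tball R m.

Lemma primes_cvg_eq (f g : nat -> R) (x y : R) :
  f p @[p --> primes_oo] --> x -> g p @[p --> primes_oo] --> y ->
  (\forall p \near primes_oo, f p = g p) -> x = y.
Proof.
move=> fx gy fg; apply/le_anti/andP; split.
  by apply: (ler_cvg_to fx gy); apply: filterS fg => p ->.
by apply: (ler_cvg_to gy fx); apply: filterS fg => p ->.
Qed.

Lemma leb_nonparallel n (q1 q2 : 'I_n -> int) B1 B2 i j :
  q1 i * q2 j != q1 j * q2 i ->
  leb (Aset q1 B1 `&` Aset q2 B2) = tball_meas B1 * tball_meas B2.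
Proof.
move=> D0.
have q10 : exists i, q1 i != 0.
  have [h|h] := eqVneq (q1 i) 0; last by exists i.
  by exists j; apply: contra_neq D0 => h'; rewrite h h' !mul0r.
have q20 : exists i, q2 i != 0.
  have [h|h] := eqVneq (q2 i) 0; last by exists i.
  by exists j; apply: contra_neq D0 => h'; rewrite h h' !mulr0.
apply: primes_cvg_eq (pair_density_nonparallel B1 B2 D0); first exact: Aset_pair_cvg.
by apply: cvgM; exact: tball_meas_cvg.
Qed.

(** The parallel case with [q1 = q2] and [a1 = a2 = 1]. *)
Lemma leb_Aset n (q : 'I_n -> int) B : (exists i, q i != 0) ->
  leb (Aset q B) = tball_meas B.
Proof.
move=> q0; have := primes_cvg_eq (@Aset_pair_cvg R m _ _ _ B B m0 q0 q0) (@tball_meas_cvg R m B m0).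
rewrite setIid; apply.
have := @pair_density_parallel R m n q q B B 1 1 q0 isT (fun i => erefl).
apply: filterS => p ->; apply: eq_bigr => j _; apply: eq_density => y.
by rewrite mul1r; split=> [[]|].
Qed.

Lemma leb_Aset_pair_le n (q1 q2 : 'I_n -> int) B1 B2 B1' B2' :
  (exists i, q1 i != 0) -> (exists i, q2 i != 0) ->
  bcentre B1' = bcentre B1 -> bcentre B2' = bcentre B2 ->
  bradius B1' <= bradius B1 -> bradius B2' <= bradius B2 ->
  leb (Aset q1 B1' `&` Aset q2 B2') <= leb (Aset q1 B1 `&` Aset q2 B2).
Proof.
move=> q10 q20 c1 c2 r1 r2.
apply: (ler_cvg_to (@Aset_pair_cvg R m _ _ _ B1' B2' m0 q10 q20) (@Aset_pair_cvg R m _ _ _ B1 B2 m0 q10 q20)).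
apply: nearW => p; apply: le_density => k H j; have [h1 h2] := H j.
by rewrite -c1 -c2; split; [apply: near_int_le h1 | apply: near_int_le h2].
Qed.

Lemma leb_Aset_pair_lel n (q1 q2 : 'I_n -> int) B1 B2 :
  (exists i, q1 i != 0) -> (exists i, q2 i != 0) ->
  leb (Aset q1 B1 `&` Aset q2 B2) <= tball_meas B1.
Proof.
move=> q10 q20; rewrite -(leb_Aset B1 q10).
have := @Aset_pair_cvg R m _ _ _ B1 B1 m0 q10 q10; rewrite setIid => c11.
apply: (ler_cvg_to (@Aset_pair_cvg R m _ _ _ B1 B2 m0 q10 q20) c11).
by apply: nearW => p; apply: le_density => k H j; have [h1 h2] := H j.
Qed.

Lemma leb_Aset_pair_ge0 n (q1 q2 : 'I_n -> int) B1 B2 :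
  (exists i, q1 i != 0) -> (exists i, q2 i != 0) ->
  0 <= leb (Aset q1 B1 `&` Aset q2 B2).
Proof.
move=> q10 q20; apply: (ler_cvg_to (cvg_cst (0 : R)) (@Aset_pair_cvg R m _ _ _ B1 B2 m0 q10 q20)).
by apply: nearW => p; exact: density_ge0.
Qed.

(** The dimensions [n] and [n'] may differ because the limiting density only sees [a1] and [a2];
    each of the [m] coordinates contributes a factor [24 * s]. *)
Lemma leb_parallel_shrink n n' (q1 q2 : 'I_n -> int) (q1' q2' : 'I_n' -> int) B1 B2
    (a1 a2 : int) (s : R) :
  (exists i, q1 i != 0) -> (exists i, q2 i != 0) ->
  (exists i, q1' i != 0) -> (exists i, q2' i != 0) ->
  a1 != 0 -> a2 != 0 ->
  (forall i, a1 * q2 i = a2 * q1 i) -> (forall i, a1 * q2' i = a2 * q1' i) ->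
  0 < bradius B1 -> 0 < bradius B2 -> bradius B1 <= 1 / 2 \/ bradius B2 <= 1 / 2 ->
  0 < s <= 1 ->
  leb (Aset q1' (tscale s B1) `&` Aset q2' (tscale s B2)) <=
  (24 * s) ^+ m * leb (Aset q1 B1 `&` Aset q2 B2).
Proof.
move=> q10 q20 q10' q20' a10 a20 par par' r1 r2 r12 sh.
apply: (ler_cvg_to (@Aset_pair_cvg R m _ _ _ (tscale s B1) (tscale s B2) m0 q10' q20')
  (cvgM (cvg_cst _) (@Aset_pair_cvg R m _ _ _ B1 B2 m0 q10 q20))).
have H1 := pair_density_parallel B1 B2 q10 a10 par.
have H2 := pair_density_parallel (tscale s B1) (tscale s B2) q10' a10 par'.
have H3 : \forall p \near primes_oo, forall j : 'I_m,
    parallel_density p a1 a2 (bcentre B1 j) (bcentre B2 j) (s * bradius B1) (s * bradius B2) <=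
    24 * s * parallel_density p a1 a2 (bcentre B1 j) (bcentre B2 j) (bradius B1) (bradius B2).
  by apply: filter_forall => j; exact: parallel_shrink.
apply: filterS3 H1 H2 H3 => p h1 h2 h3; rewrite h2.
rewrite -[leRHS]/((24 * s) ^+ m * pair_density q1 q2 B1 B2 p) h1.
rewrite -[X in _ ^+ X]card_ord -prodr_const -big_split; apply: ler_prod => j _ /=.
by rewrite density_ge0 /= h3.
Qed.

(** Once [2 <= p * r], each coordinate has density at most [2 * r + 1 / p <= 3 * r], and always at
    most 1; the lower bound is [density_fp_near_ge]. *)
Lemma tball_meas_bounds B : 0 < bradius B ->
  (Num.min 1 (bradius B) / 2) ^+ m <= tball_meas B <= (3 * Num.min 1 (bradius B)) ^+ m.
Proof.
set r := bradius B => r0; have mr0 : 0 < Num.min 1 r by rewrite lt_min ltr01.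
have near2 : \forall p \near primes_oo, prime p /\ 2 <= p%:R * r.
  apply: (near_primes (N := Num.truncn (2 / r))) => p pp.
  rewrite -(ler_nat R) => /(lt_le_trans (truncnS_gt _)); rewrite ltr_pdivrMr //.
  by move=> /ltW.
have tc := @tball_meas_cvg R m B m0.
apply/andP; split.
  apply: (ler_cvg_to (cvg_cst _) tc); apply: filterS near2 => p [pp pr].
  rewrite -[X in _ ^+ X]card_ord -prodr_const; apply: ler_prod => j _ /=.
  by rewrite divr_ge0 ?(ltW mr0) //= density_fp_near_ge.
apply: (ler_cvg_to tc (cvg_cst _)); apply: filterS near2 => p [pp pr].
rewrite -[X in _ ^+ X]card_ord -prodr_const; apply: ler_prod => j _ /=.
rewrite density_ge0 /=; have d1 := density_le1 R (@fp_near R p (bcentre B j) r).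
have := density_fp_near_le pp (bcentre B j) (ltW r0).
have p0 : 0 < p%:R :> R by rewrite ltr0n prime_gt0.
have pr' : 1 / p%:R <= r / 2 by rewrite ler_pdivrMr //; lra.
rewrite -/r /Num.min; case: ifP => h; lra.
Qed.

Lemma tball_meas_ge0 B : 0 < bradius B -> 0 <= tball_meas B.
Proof.
move=> r0; have /andP[h _] := tball_meas_bounds r0; apply: le_trans h.
by rewrite exprn_ge0 // divr_ge0 // le_min ler01 ltW.
Qed.
End Measures.

(** * Counting parallel integer vectors *)

Lemma leq_expn2r (a b e : nat) : (a <= b)%N -> (a ^ e <= b ^ e)%N.
Proof. by case: e => // e; rewrite leq_exp2r. Qed.

Definition sphere (n Q t : nat) : {set {ffun 'I_n -> 'I_(2 * Q + 1)}} :=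
  [set k : {ffun 'I_n -> 'I_(2 * Q + 1)} | supnorm (qvec k) == t]%SET.

Section Counting.
Variable n : nat.
Implicit Types (Q t g : nat) (q : 'I_n -> int).

Lemma in_sphere Q t (k : {ffun 'I_n -> 'I_(2 * Q + 1)}) :
  (k \in sphere n Q t) = (supnorm (qvec k) == t).
Proof. by rewrite finset.inE. Qed.

Lemma supnorm_leP q t : reflect (forall i, (absz (q i) <= t)%N) (supnorm q <= t)%N.
Proof.
apply: (iffP idP) => [/bigmax_leqP H i|H]; first exact: H.
by apply/bigmax_leqP => i _.
Qed.

Lemma absz_le_supnorm q i : (absz (q i) <= supnorm q)%N.
Proof. by have /supnorm_leP := leqnn (supnorm q). Qed.

Lemma supnorm_qvec Q (k : {ffun 'I_n -> 'I_(2 * Q + 1)}) : (supnorm (qvec k) <= Q)%N.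
Proof. by apply/supnorm_leP => i; rewrite /qvec; have := ltn_ord (k i); lia. Qed.

Lemma supnorm_scale (c : int) q q' : (forall i, q' i = c * q i) ->
  supnorm q' = (absz c * supnorm q)%N.
Proof.
move=> qq'; apply/eqP; rewrite eqn_leq; apply/andP; split.
  by apply/supnorm_leP => i; rewrite qq' abszM leq_mul2l absz_le_supnorm orbT.
have [i0|n0] := pickP 'I_n; last first.
  by rewrite /supnorm big_pred0 // muln0.
have [i _ ->] : {i | i \in 'I_n & supnorm q = absz (q i)}.
  by apply: eq_bigmax_cond; apply/card_gt0P; exists i0.
by rewrite -abszM -qq' absz_le_supnorm.
Qed.

Lemma eq_supnorm q q' : (forall i, absz (q' i) = absz (q i)) -> supnorm q' = supnorm q.
Proof. by move=> qq'; apply: eq_bigr => i _. Qed.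

Lemma supnorm_attained q : (0 < supnorm q)%N -> exists i, absz (q i) = supnorm q.
Proof.
move=> q0; have [i0|n0] := pickP 'I_n; last by rewrite /supnorm big_pred0 in q0.
have [i _ ->] : {i | i \in 'I_n & supnorm q = absz (q i)}.
  by apply: eq_bigmax_cond; apply/card_gt0P; exists i0.
by exists i.
Qed.

Lemma qvec_surj Q q : (supnorm q <= Q)%N ->
  exists k : {ffun 'I_n -> 'I_(2 * Q + 1)}, forall i, qvec k i = q i.
Proof.
move=> /supnorm_leP qQ.
have H i : (absz (q i + Q%:Z)%R < 2 * Q + 1)%N by have := qQ i; lia.
by exists [ffun i => Ordinal (H i)] => i; rewrite /qvec ffunE /=; have := qQ i; lia.
Qed.

Lemma qvec_inj Q (k k' : {ffun 'I_n -> 'I_(2 * Q + 1)}) :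
  (forall i, qvec k i = qvec k' i) -> k = k'.
Proof.
move=> kk'; apply/ffunP => i; apply: val_inj; have := kk' i.
by rewrite /qvec /= => /addIr [].
Qed.

Lemma card_supnorm_ball Q t : (t <= Q)%N ->
  #|[set k : {ffun 'I_n -> 'I_(2 * Q + 1)} | (supnorm (qvec k) <= t)%N]%SET| = ((2 * t + 1) ^ n)%N.
Proof.
move=> tQ.
pose A : {set 'I_(2 * Q + 1)} := [set j : 'I_(2 * Q + 1) | (absz ((j : nat)%:Z - Q%:Z)%R <= t)%N]%SET.
have cA : #|A| = (2 * t + 1)%N.
  have H (j : 'I_(2 * t + 1)) : (Q - t + j < 2 * Q + 1)%N by have := ltn_ord j; lia.
  have inj : injective (fun j => Ordinal (H j)) by move=> j j' [] /addnI /val_inj.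
  rewrite -[RHS]card_ord -(card_imset _ inj); apply: eq_card => j.
  rewrite finset.inE; apply/idP/imsetP => [h|[i _ ->]]; last first.
    by have := ltn_ord i; rewrite /=; lia.
  have H' : (j - (Q - t) < 2 * t + 1)%N by lia.
  by exists (Ordinal H') => //; apply: val_inj => /=; lia.
transitivity (foldr muln 1%N [seq #|A| | i : 'I_n]).
  rewrite -card_family; apply: eq_card => k; rewrite finset.inE.
  apply/supnorm_leP/familyP => H i; have := H i; by rewrite finset.inE.
by rewrite foldrE big_image /= prod_nat_const card_ord cA.
Qed.

(** The difference of the cardinals of two concentric cubes, factored as a difference of [n]-th
    powers. *)
Lemma card_sphereE Q t : (0 < t <= Q)%N ->
  #|sphere n Q t| = (2 * \sum_(i < n) (2 * t + 1) ^ (n.-1 - i) * (2 * t - 1) ^ i)%N.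
Proof.
move=> /andP[t0 tQ].
have E : #|[set k : {ffun 'I_n -> 'I_(2 * Q + 1)} | (supnorm (qvec k) <= t)%N]%SET| =
   (#|sphere n Q t| + #|[set k : {ffun 'I_n -> 'I_(2 * Q + 1)} | (supnorm (qvec k) <= t.-1)%N]%SET|)%N.
  rewrite -cardsUI (_ : _ :&: _ = finset.set0)%SET.
    rewrite cards0 addn0; apply: eq_card => k; rewrite !finset.inE; lia.
  by apply/setP => k; rewrite !finset.inE; lia.
move: E; rewrite !card_supnorm_ball //; last by lia.
have -> : (2 * t.-1 + 1 = 2 * t - 1)%N by lia.
move=> E; have -> : #|sphere n Q t| = ((2 * t + 1) ^ n - (2 * t - 1) ^ n)%N by rewrite E addnK.
by rewrite subn_exp; congr (_ * _)%N; lia.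
Qed.

Lemma card_sphere_ge Q t : (0 < n)%N -> (0 < t <= Q)%N -> (t ^ n.-1 <= #|sphere n Q t|)%N.
Proof.
move=> n0 tQ; rewrite card_sphereE //.
rewrite (bigD1 (Ordinal n0)) //= subn0 expn0 muln1.
apply: leq_trans (leq_pmull _ _) => //; apply: leq_trans (leq_addr _ _).
by apply: leq_expn2r; lia.
Qed.

Lemma card_sphere_le Q t : (0 < t <= Q)%N ->
  (#|sphere n Q t| <= 2 * n * 3 ^ n.-1 * t ^ n.-1)%N.
Proof.
move=> tQ; rewrite card_sphereE // -!mulnA leq_mul2l /= -expnMn.
apply: (@leq_trans (\sum_(i < n) (3 * t) ^ n.-1)%N); last by rewrite sum_nat_const card_ord.
apply: leq_sum => i _.
have -> : ((3 * t) ^ n.-1 = (3 * t) ^ (n.-1 - i) * (3 * t) ^ i)%N.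
  by rewrite -expnD subnK //; have := ltn_ord i; lia.
by apply: leq_mul; apply: leq_expn2r; lia.
Qed.

(** Parallelism without division; [sg] is meant to be 1 or -1 and tells whether the vectors point
    the same way. *)
Definition parallel_pairs Q t1 t2 (sg : int) :
    {set {ffun 'I_n -> 'I_(2 * Q + 1)} * {ffun 'I_n -> 'I_(2 * Q + 1)}} :=
  [set kk : {ffun 'I_n -> 'I_(2 * Q + 1)} * {ffun 'I_n -> 'I_(2 * Q + 1)} |
   [&& kk.1 \in sphere n Q t1, kk.2 \in sphere n Q t2 &
     [forall i, t1%:Z * qvec kk.2 i == sg * t2%:Z * qvec kk.1 i]]]%SET.

Lemma parallel_pairsP Q t1 t2 sg kk : reflect
  [/\ supnorm (qvec kk.1) = t1, supnorm (qvec kk.2) = t2 &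
    forall i, t1%:Z * qvec kk.2 i = sg * t2%:Z * qvec kk.1 i]
  (kk \in parallel_pairs Q t1 t2 sg).
Proof.
rewrite finset.inE !in_sphere; apply: (iffP and3P) => -[].
  by move=> /eqP h1 /eqP h2 /forallP H; split => // i; exact/eqP.
by move=> -> -> H; split => //; apply/forallP => i; apply/eqP.
Qed.

Lemma nonparallel_or Q t1 t2 (k1 k2 : {ffun 'I_n -> 'I_(2 * Q + 1)}) :
  (0 < t1)%N -> (0 < t2)%N -> k1 \in sphere n Q t1 -> k2 \in sphere n Q t2 ->
  (exists i j, qvec k1 i * qvec k2 j != qvec k1 j * qvec k2 i) \/
  (k1, k2) \in parallel_pairs Q t1 t2 1 \/ (k1, k2) \in parallel_pairs Q t1 t2 (-1).
Proof.
rewrite !in_sphere => t10 t20 /eqP n1 /eqP n2.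
set q1 := qvec k1 in n1 *; set q2 := qvec k2 in n2 *.
have [h|h] := pselect (exists i j, q1 i * q2 j != q1 j * q2 i); first by left.
have E i j : q1 i * q2 j = q1 j * q2 i.
  by apply/eqP; apply: contra_notT h => h'; exists i, j.
right; have [i qi] : exists i, absz (q1 i) = t1 by rewrite -n1; apply: supnorm_attained; rewrite n1.
have [j qj] : exists j, absz (q2 j) = t2 by rewrite -n2; apply: supnorm_attained; rewrite n2.
(* A largest coordinate of [q1] is also one of [q2]: the vanishing minor gives
   [t1 * t2 = |q1 j| * |q2 i| <= t1 * |q2 i|]. The sign at this coordinate then determines all the
   others. *)
have q2i : absz (q2 i) = t2.
  apply/eqP; rewrite eqn_leq -{1}n2 absz_le_supnorm /=.
  have := congr1 absz (E i j); rewrite !abszM qi qj => Eij.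
  have : (t1 * t2 <= t1 * absz (q2 i))%N.
    by rewrite Eij leq_mul2r -n1 absz_le_supnorm orbT.
  by rewrite leq_mul2l; lia.
have [sg] : exists sg : int, (sg = 1 \/ sg = -1) /\ q2 i * t1%:Z = sg * t2%:Z * q1 i.
  have [|] := leP 0 (q1 i); have [|] := leP 0 (q2 i) => h1 h2.
  - by exists 1; split; [left | nia].
  - by exists (-1); split; [right | nia].
  - by exists (-1); split; [right | nia].
  - by exists 1; split; [left | nia].
move=> [sgh sgE].
have H l : t1%:Z * q2 l = sg * t2%:Z * q1 l.
  have q1i0 : q1 i != 0 by rewrite -absz_eq0 qi; lia.
  apply: (mulfI q1i0).
  rewrite mulrCA E; nia.
case: sgh H => -> H; [left | right]; apply/parallel_pairsP; split => //.
Qed.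
End Counting.

Section ParallelCount.
Variable n : nat.

(** With [g] the gcd, a vector [u] of norm [g] yields the pair [(t1 / g) u], [sg (t2 / g) u]. *)
Lemma card_parallel_pairs_ge (Q t1 t2 : nat) (sg : int) :
  (0 < t1 <= Q)%N -> (0 < t2 <= Q)%N -> absz sg = 1%N ->
  (#|sphere n Q (gcdn t1 t2)| <= #|parallel_pairs n Q t1 t2 sg|)%N.
Proof.
move=> /andP[t10 t1Q] /andP[t20 t2Q] sg1; set g := gcdn t1 t2.
have g0 : (0 < g)%N by rewrite gcdn_gt0 t10.
have [g1 g2] : (g %| t1)%N /\ (g %| t2)%N by rewrite dvdn_gcdl dvdn_gcdr.
have E1 := divnK g1; have E2 := divnK g2.
set b1 := (t1 %/ g)%N in E1; set b2 := (t2 %/ g)%N in E2.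
have /choice[f fP] : forall u : {ffun 'I_n -> 'I_(2 * Q + 1)},
    exists kk : {ffun 'I_n -> 'I_(2 * Q + 1)} * {ffun 'I_n -> 'I_(2 * Q + 1)},
    u \in sphere n Q g -> (forall i, qvec kk.1 i = b1%:Z * qvec u i) /\
      (forall i, qvec kk.2 i = sg * b2%:Z * qvec u i).
  move=> u; case: (boolP (u \in _)) => [|_]; last by exists (u, u).
  rewrite in_sphere => /eqP ug.
  have [|k1 k1P] := @qvec_surj n Q (fun i => b1%:Z * qvec u i).
    by rewrite (supnorm_scale (c := b1%:Z) (q := qvec u)) // ug /= E1.
  have [|k2 k2P] := @qvec_surj n Q (fun i => sg * b2%:Z * qvec u i).
    by rewrite (supnorm_scale (c := sg * b2%:Z) (q := qvec u)) // ug abszM sg1 mul1n /= E2.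
  by exists (k1, k2).
have finj : {in sphere n Q g &, injective f}.
  move=> u v uS vS fuv; apply: qvec_inj => i.
  have [h1 _] := fP u uS; have [h2 _] := fP v vS.
  have b10 : b1%:Z != 0 by rewrite eqz_nat; apply/eqP => b1E; move: E1; rewrite b1E; lia.
  by apply: (mulfI b10); rewrite -h1 -h2 fuv.
rewrite -(card_in_imset finj); apply: subset_leq_card; apply/fintype.subsetP => kk.
move=> /imsetP[u uS ->]; have [h1 h2] := fP u uS.
move: uS; rewrite in_sphere => /eqP ug.
apply/parallel_pairsP; split.
- by rewrite (supnorm_scale h1) ug /= E1.
- by rewrite (supnorm_scale h2) ug abszM sg1 mul1n /= E2.
by move=> i; rewrite h1 h2 -E1 -E2 !PoszM; ring.
Qed.

(** The quotients [b1] and [b2] of [t1] and [t2] by the gcd are coprime, so by Gauss's lemma [b1]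
    divides every coordinate of the first vector. Division by [b1] leaves a vector of norm [g] that
    determines the pair. *)
Lemma card_parallel_pairs_le (Q t1 t2 : nat) (sg : int) :
  (0 < t1 <= Q)%N -> (0 < t2 <= Q)%N -> absz sg = 1%N ->
  (#|parallel_pairs n Q t1 t2 sg| <= #|sphere n Q (gcdn t1 t2)|)%N.
Proof.
move=> /andP[t10 t1Q] /andP[t20 t2Q] sg1; set g := gcdn t1 t2.
have g0 : (0 < g)%N by rewrite gcdn_gt0 t10.
have [g1 g2] : (g %| t1)%N /\ (g %| t2)%N by rewrite dvdn_gcdl dvdn_gcdr.
have E1 := divnK g1; have E2 := divnK g2.
have cop : coprime (t1 %/ g) (t2 %/ g).
  by rewrite /coprime -(eqn_pmul2r g0) muln_gcdl E1 E2 mul1n.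
set b1 := (t1 %/ g)%N in E1 cop; set b2 := (t2 %/ g)%N in E2 cop.
have b10 : (0 < b1)%N by move: t10; rewrite -E1 muln_gt0 => /andP[].
have gZ : g%:Z != 0 by rewrite eqz_nat -lt0n.
have /choice[f fP] : forall kk : {ffun 'I_n -> 'I_(2 * Q + 1)} * {ffun 'I_n -> 'I_(2 * Q + 1)},
    exists u : {ffun 'I_n -> 'I_(2 * Q + 1)}, kk \in parallel_pairs n Q t1 t2 sg ->
    u \in sphere n Q g /\ (forall i, qvec kk.1 i = b1%:Z * qvec u i).
  move=> kk; case: (boolP (kk \in _)) => [|_]; last by exists kk.1.
  move=> /parallel_pairsP[n1 n2 par].
  have div i : (b1%:Z %| qvec kk.1 i)%Z.
    have : b1%:Z * qvec kk.2 i = sg * b2%:Z * qvec kk.1 i.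
      by apply: (mulfI gZ); have := par i; rewrite -E1 -E2 !PoszM => h; lia.
    move=> /(congr1 absz); rewrite !abszM sg1 mul1n /= => h.
    by rewrite dvdzE /= -(Gauss_dvdr _ cop) -h dvdn_mulr.
  pose v i := (qvec kk.1 i %/ b1%:Z)%Z.
  have vE i : qvec kk.1 i = b1%:Z * v i by rewrite mulrC divzK.
  have vn : supnorm v = g.
    have := supnorm_scale vE; rewrite n1 /= -E1 => /eqP.
    by rewrite eqn_pmul2l // => /eqP.
  have [|u uP] := @qvec_surj n Q v.
    by rewrite vn; apply: leq_trans t1Q; apply: dvdn_leq.
  exists u => _; rewrite in_sphere; split; last by move=> i; rewrite uP vE.
  by apply/eqP; rewrite -vn; apply: eq_supnorm => i; rewrite uP.
have finj : {in parallel_pairs n Q t1 t2 sg &, injective f}.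
  move=> kk kk' kS kS' ff.
  have [_ h1] := fP _ kS; have [_ h2] := fP _ kS'.
  have e1 : kk.1 = kk'.1 by apply: qvec_inj => i; rewrite h1 h2 ff.
  have e2 : kk.2 = kk'.2.
    apply: qvec_inj => i.
    have /parallel_pairsP[_ _ p1] := kS; have /parallel_pairsP[_ _ p2] := kS'.
    have t1Z : t1%:Z != 0 by rewrite eqz_nat -lt0n.
    by apply: (mulfI t1Z); rewrite p1 p2 e1.
  by move: kk kk' e1 e2 {kS kS' ff h1 h2} => [? ?] [? ?] /= -> ->.
rewrite -(card_in_imset finj); apply: subset_leq_card; apply/fintype.subsetP => u.
by move=> /imsetP[kk kS ->]; have [] := fP _ kS.
Qed.
End ParallelCount.

(** * Comparison of the quasi-independence sums *)

Section Powers.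
Variables (R : realType) (m : nat).
Hypothesis m0 : (0 < m)%N.
Implicit Types (k t a b : nat) (w : R).

(** Its [m]-th power is [t ^ (-k)], which balances the growth by [t ^ k] of the number of vectors of
    norm [t]. *)
Definition shrink k t : R := t%:R `^ (- (k%:R / m%:R)).

Lemma shrink_itv k t : (0 < t)%N -> 0 < shrink k t <= 1.
Proof.
move=> t0; rewrite powR_gt0 ?ltr0n //= /shrink -[leRHS](powRr0 t%:R).
by apply: ler_powR; rewrite ?ler1n // oppr_le0 divr_ge0 ?ler0n.
Qed.

Lemma shrink_expr k t : (0 < t)%N -> shrink k t ^+ m = (t%:R ^+ k)^-1.
Proof.
move=> t0; rewrite -powR_mulrn ?powR_ge0 // -powRrM mulNr divfK.
  by rewrite powRN powR_mulrn ?ler0n.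
by rewrite pnatr_eq0 -lt0n.
Qed.

(** Both balls of a pair are thereby shrunk by the same factor [shrink k a]; the discrepancy becomes
    an increase of the exponent from [w] to [w + k]. *)
Lemma shrink_mul k a b w : (0 < a)%N -> (0 < b)%N ->
  (a%:R / b%:R) `^ (w / m%:R) * shrink k b =
  shrink k a * (a%:R / b%:R) `^ ((w + k%:R) / m%:R).
Proof.
move=> a0 b0; have a0R : 0 < a%:R :> R by rewrite ltr0n.
have b0R : 0 < b%:R :> R by rewrite ltr0n.
have ab0 : a%:R / b%:R != 0 :> R by rewrite gt_eqF // divr_gt0.
rewrite mulrDl powRD; last by rewrite ab0 implybT.
rewrite mulrCA; congr (_ * _); rewrite /shrink.
have -> : a%:R `^ (- (k%:R / m%:R)) =
    (a%:R / b%:R) `^ (- (k%:R / m%:R)) * b%:R `^ (- (k%:R / m%:R)) :> R.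
  by rewrite -powRM ?divr_ge0 ?ler0n // divfK // gt_eqF.
rewrite mulrAC -powRD; last by rewrite ab0 implybT.
by rewrite addNr powRr0 mul1r.
Qed.

Lemma gcd_ratio_itv a b : (0 < a)%N -> 0 < ((gcdn a b)%:R / a%:R : R) <= 1.
Proof.
move=> a0; rewrite divr_gt0 ?ltr0n ?gcdn_gt0 ?a0 //=.
by rewrite ler_pdivrMr ?ltr0n // mul1r ler_nat dvdn_leq // dvdn_gcdl.
Qed.

Lemma ratio_itv a b : (0 < a)%N -> (a <= b)%N -> 0 < (a%:R / b%:R : R) <= 1.
Proof.
move=> a0 ab; have b0 := leq_trans a0 ab.
by rewrite divr_gt0 ?ltr0n //= ler_pdivrMr ?ltr0n // mul1r ler_nat.
Qed.

Lemma powR_unit_itv (x w : R) : 0 < x <= 1 -> 0 <= w -> 0 < x `^ w <= 1.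
Proof.
move=> /[dup] xh /andP[x0 _] w0; rewrite powR_gt0 //=.
by rewrite -(powRr0 x); apply: ger_powR.
Qed.
End Powers.

Section NormTerms.
Variables (R : realType) (m : nat).
Hypothesis m0 : (0 < m)%N.
Implicit Types (w : R) (B : nat -> tball R m).

Definition pair_term n w B (a b : nat) (q1 q2 : 'I_n -> int) : R :=
  ((gcdn a b)%:R / a%:R) `^ w *
  leb (Aset q1 (B a) `&` Aset q2 (tscale ((a%:R / b%:R) `^ (w / m%:R)) (B b))).

Definition norm_term n w B (Q a b : nat) : R :=
  \sum_(kk in finset.setX (sphere n Q a) (sphere n Q b))
    pair_term w B a b (qvec kk.1) (qvec kk.2).

Lemma sum_sphere (V : nmodType) n Q (P : pred nat)
    (F : {ffun 'I_n -> 'I_(2 * Q + 1)} -> V) :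
  \sum_(k | P (supnorm (qvec k))) F k =
  \sum_(t < Q.+1 | P t) \sum_(k in sphere n Q t) F k.
Proof.
pose nm (k : {ffun 'I_n -> 'I_(2 * Q + 1)}) : 'I_Q.+1 := inord (supnorm (qvec k)).
have nmE k : nm k = supnorm (qvec k) :> nat by rewrite inordK // ltnS supnorm_qvec.
rewrite (partition_big nm (fun t => P t)) => [|k]; last by rewrite nmE.
apply: eq_bigr => t Pt; apply: eq_bigl => k; rewrite in_sphere -val_eqE /= nmE.
by apply/andP/eqP => [[_ /eqP]|kt] //; rewrite kt.
Qed.

Lemma S1E n B Q : S1 n B Q =
  \sum_(t < Q.+1 | (1 <= t)%N) #|sphere n Q t|%:R * tball_meas (B t).
Proof.
rewrite /S1 (sum_sphere (fun t => (1 <= t)%N) (fun k => tball_meas (B (supnorm (qvec k))))).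
apply: eq_bigr => t _; rewrite mulr_natl -sumr_const.
by apply: eq_bigr => k; rewrite in_sphere => /eqP ->.
Qed.

Lemma S2E n w B Q : S2 n w B Q =
  \sum_(a < Q.+1 | (1 <= a)%N) \sum_(b < Q.+1 | (a <= b)%N) norm_term n w B Q a b.
Proof.
rewrite /S2 (sum_sphere (fun t => (1 <= t)%N)); apply: eq_bigr => a _.
transitivity (\sum_(k1 in sphere n Q a) \sum_(b < Q.+1 | (a <= b)%N)
    \sum_(k2 in sphere n Q b) pair_term w B a b (qvec k1) (qvec k2)).
  apply: eq_bigr => k1; rewrite in_sphere => /eqP k1a; rewrite k1a.
  rewrite (sum_sphere (fun t => (a <= t)%N)); apply: eq_bigr => b _.
  by apply: eq_bigr => k2; rewrite in_sphere => /eqP ->.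
rewrite exchange_big; apply: eq_bigr => b _.
rewrite pair_big_dep /norm_term; apply: eq_bigl => -[k1 k2].
by rewrite finset.in_setX.
Qed.

Lemma sphere_neq0 n Q t (k : {ffun 'I_n -> 'I_(2 * Q + 1)}) : (0 < t)%N ->
  k \in sphere n Q t -> exists i, qvec k i != 0.
Proof.
move=> t0; rewrite in_sphere => /eqP kt.
have [|i ki] := @supnorm_attained n (qvec k); first by rewrite kt.
by exists i; rewrite -absz_eq0 ki kt -lt0n.
Qed.

Section Bounds.
Variables (w : R) (B : nat -> tball R m).
Hypothesis w0 : 0 <= w.
Hypothesis B0 : forall t, (0 < t)%N -> 0 < bradius (B t).

Lemma pair_term_ge0 n (q1 q2 : 'I_n -> int) a b :
  (exists i, q1 i != 0) -> (exists i, q2 i != 0) -> 0 <= pair_term w B a b q1 q2.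
Proof.
by move=> q10 q20; rewrite mulr_ge0 ?powR_ge0 //; apply: leb_Aset_pair_ge0.
Qed.

Lemma norm_term_ge0 n Q a b : (0 < a)%N -> (0 < b)%N -> 0 <= norm_term n w B Q a b.
Proof.
move=> a0 b0; apply: sumr_ge0 => -[k1 k2] /=; rewrite finset.in_setX => /andP[k1a k2b].
by apply: pair_term_ge0; [exact: sphere_neq0 k1a | exact: sphere_neq0 k2b].
Qed.

Lemma pair_term_le_exponent n (q1 q2 : 'I_n -> int) a b w' : w <= w' ->
  (0 < a)%N -> (a <= b)%N -> (exists i, q1 i != 0) -> (exists i, q2 i != 0) ->
  pair_term w' B a b q1 q2 <= pair_term w B a b q1 q2.
Proof.
move=> ww' a0 ab q10 q20; apply: ler_pM; rewrite ?powR_ge0 //.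
- by apply: leb_Aset_pair_ge0.
- by apply: ger_powR => //; exact: gcd_ratio_itv.
apply: leb_Aset_pair_le => //=; apply: ler_wpM2r.
  by apply/ltW/B0; exact: leq_trans ab.
apply: ger_powR; first exact: ratio_itv.
by rewrite ler_pM2r // invr_gt0 ltr0n.
Qed.

Lemma pair_term_le_tball n (q1 q2 : 'I_n -> int) a b :
  (0 < a)%N -> (exists i, q1 i != 0) -> (exists i, q2 i != 0) ->
  pair_term w B a b q1 q2 <= tball_meas (B a).
Proof.
move=> a0 q10 q20; have /andP[p0 p1] := powR_unit_itv (gcd_ratio_itv R b a0) w0.
have le1 := leb_Aset_pair_lel m0 (B a) (tscale ((a%:R / b%:R) `^ (w / m%:R)) (B b)) q10 q20.
by apply: le_trans le1; rewrite ler_piMl //; apply: leb_Aset_pair_ge0.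
Qed.

Lemma pair_term_nonparallel n (q1 q2 : 'I_n -> int) a b i j :
  (0 < a)%N -> (a <= b)%N -> q1 i * q2 j != q1 j * q2 i ->
  pair_term w B a b q1 q2 <= tball_meas (B a) * tball_meas (B b).
Proof.
move=> a0 ab D0; have b0 := leq_trans a0 ab.
have /andP[p0 p1] := powR_unit_itv (gcd_ratio_itv R b a0) w0.
have q10 : exists i, q1 i != 0.
  have [h|h] := eqVneq (q1 i) 0; last by exists i.
  by exists j; apply: contra_neq D0 => h'; rewrite h h' !mul0r.
have q20 : exists i, q2 i != 0.
  have [h|h] := eqVneq (q2 i) 0; last by exists i.
  by exists j; apply: contra_neq D0 => h'; rewrite h h' !mulr0.
rewrite -(leb_nonparallel m0 (B a) (B b) D0).
apply: le_trans (_ : leb (Aset q1 (B a) `&` Aset q2 (tscale ((a%:R / b%:R) `^ (w / m%:R)) (B b))) <= _).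
  by rewrite /pair_term ler_piMl //; apply: leb_Aset_pair_ge0.
apply: leb_Aset_pair_le => //=; rewrite ler_piMl ?(ltW (B0 b0)) //.
have wm0 : 0 <= w / m%:R by rewrite divr_ge0.
by have /andP[] := powR_unit_itv (ratio_itv R a0 ab) wm0.
Qed.

(** Every pair is non-parallel or lies in one of the two parallel families. All terms are
    nonnegative, so the product bound may be summed over all pairs. *)
Lemma norm_term_split n Q a b : (0 < a)%N -> (a <= b)%N ->
  norm_term n w B Q a b <=
  (#|sphere n Q a|%:R * tball_meas (B a)) * (#|sphere n Q b|%:R * tball_meas (B b)) +
  \sum_(kk in parallel_pairs n Q a b 1) pair_term w B a b (qvec kk.1) (qvec kk.2) +
  \sum_(kk in parallel_pairs n Q a b (-1)) pair_term w B a b (qvec kk.1) (qvec kk.2).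
Proof.
move=> a0 ab; have b0 := leq_trans a0 ab.
pose pt (kk : {ffun 'I_n -> 'I_(2 * Q + 1)} * {ffun 'I_n -> 'I_(2 * Q + 1)}) :=
  pair_term w B a b (qvec kk.1) (qvec kk.2).
have parE sg : \sum_(kk in parallel_pairs n Q a b sg) pt kk =
    \sum_(kk in finset.setX (sphere n Q a) (sphere n Q b))
      (kk \in parallel_pairs n Q a b sg)%:R * pt kk.
  rewrite big_mkcond [RHS]big_mkcond; apply: eq_bigr => -[k1 k2] _.
  case: (boolP ((k1, k2) \in parallel_pairs n Q a b sg)) => [h|_]; last by rewrite mul0r if_same.
  have /parallel_pairsP[/= n1 n2 _] := h.
  by rewrite finset.in_setX !in_sphere n1 n2 !eqxx mul1r.
have -> : (#|sphere n Q a|%:R * tball_meas (B a)) * (#|sphere n Q b|%:R * tball_meas (B b)) =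
    \sum_(kk in finset.setX (sphere n Q a) (sphere n Q b)) (tball_meas (B a) * tball_meas (B b)).
  by rewrite sumr_const cardsX -[RHS]mulr_natl natrM; ring.
rewrite !parE -!big_split /=; apply: ler_sum => -[k1 k2]; rewrite finset.in_setX /=.
move=> /andP[k1a k2b].
have pt0 : 0 <= pt (k1, k2).
  by apply: pair_term_ge0; [exact: sphere_neq0 k1a | exact: sphere_neq0 k2b].
have tt0 : 0 <= tball_meas (B a) * tball_meas (B b).
  by rewrite mulr_ge0 // tball_meas_ge0 // B0.
have pb (c : bool) : 0 <= c%:R * pt (k1, k2) by rewrite mulr_ge0.
have [[i [j D]]|[->|->]] := nonparallel_or a0 b0 k1a k2b.
- by apply: le_trans (pair_term_nonparallel a0 ab D) _; rewrite -addrA lerDl addr_ge0.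
- by rewrite mul1r addrAC lerDr addr_ge0.
- by rewrite mul1r lerDr addr_ge0.
Qed.
End Bounds.
End NormTerms.

Section Comparison.
Variables (R : realType) (n m k : nat) (w : R) (B : nat -> tball R m).
Hypothesis n0 : (0 < n)%N.
Hypothesis m0 : (0 < m)%N.
Hypothesis B0 : forall t, (0 < t)%N -> 0 < bradius (B t).

Let w' : R := Num.max (w - k%:R) 0.
Let B' (t : nat) : tball R m := tscale (shrink R m k t) (B t).
Let c1 : nat := (2 * (n + k) * 3 ^ (n + k).-1)%N.

Let w'0 : 0 <= w'. Proof. by rewrite le_max lexx orbT. Qed.
Let ww' : w <= w' + k%:R. Proof. by rewrite -lerBlDr le_max lexx. Qed.
Let B'0 t : (0 < t)%N -> 0 < bradius (B' t).
Proof. by move=> t0; rewrite mulr_gt0 ?B0 //; have /andP[] := shrink_itv R m k t0. Qed.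
Let nk0 : (0 < n + k)%N. Proof. by rewrite ltn_addr. Qed.
Let nk1 : (n + k).-1 = (n.-1 + k)%N. Proof. by rewrite -(prednK n0) addSn. Qed.

(** The cardinal is at least [t ^ (n + k - 1)], and the [m]-th power of the shrinking factor cancels
    [t ^ k]. *)
Lemma shrunk_mass_ge Q t : (0 < t <= Q)%N ->
  t%:R ^+ n.-1 * (Num.min 1 (bradius (B t)) / 2) ^+ m <=
  #|sphere (n + k) Q t|%:R * tball_meas (B' t).
Proof.
move=> /[dup] tQ /andP[t0 _]; have t0R : 0 < t%:R :> R by rewrite ltr0n.
have /andP[s0 s1] := shrink_itv R m k t0.
have r0 := B0 t0.
have mr : 0 < Num.min 1 (bradius (B t)) by rewrite lt_min ltr01.
apply: (@le_trans _ _ (t%:R ^+ (n + k).-1 * (shrink R m k t * (Num.min 1 (bradius (B t)) / 2)) ^+ m)).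
  by rewrite [(shrink _ _ _ _ * _) ^+ _]exprMn shrink_expr // nk1 exprD -!mulrA mulVKf // expf_neq0 // gt_eqF.
apply: ler_pM; rewrite ?exprn_ge0 ?mulr_ge0 ?(ltW s0) ?(ltW mr) //.
  by rewrite -natrX ler_nat card_sphere_ge.
have /andP[h _] := tball_meas_bounds m0 (B'0 t0); apply: le_trans h.
rewrite mulrA; apply: lerXn2r; rewrite ?nnegrE ?divr_ge0 ?mulr_ge0 ?(ltW s0) ?(ltW mr) //.
  by rewrite le_min ler01 ltW // B'0.
rewrite ler_pM2r ?invr_gt0 // le_min; apply/andP; split.
  by apply: mulr_ile1; rewrite ?(ltW s0) ?(ltW mr) // ge_min lexx.
by apply: ler_wpM2l; [exact: ltW | rewrite ge_min lexx orbT].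
Qed.

(** Comparison norm by norm: [6 ^+ m] is the ratio of the two bounds in [tball_meas_bounds], and
    [c2] is the constant of [card_sphere_le]. *)
Lemma S1_shrunk_ge : exists2 c : R, 0 < c & forall Q, c * S1 n B Q <= S1 (n + k) B' Q.
Proof.
pose c2 : R := (2 * n * 3 ^ n.-1)%:R.
have c20 : 0 < c2 by rewrite ltr0n !muln_gt0 n0 expn_gt0.
exists (6 ^+ m * c2)^-1; first by rewrite invr_gt0 mulr_gt0 // exprn_gt0.
move=> Q; rewrite !S1E mulr_sumr; apply: ler_sum => t t0.
have tQ : (0 < t <= Q)%N by rewrite t0 -ltnS ltn_ord.
apply: le_trans (shrunk_mass_ge tQ).
rewrite mulrC ler_pdivrMr ?mulr_gt0 ?exprn_gt0 //.
have mr : 0 < Num.min 1 (bradius (B t)) by rewrite lt_min ltr01 B0.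
have -> : (t : nat)%:R ^+ n.-1 * (Num.min 1 (bradius (B t)) / 2) ^+ m * (6 ^+ m * c2) =
   (c2 * (t : nat)%:R ^+ n.-1) * (3 * Num.min 1 (bradius (B t))) ^+ m.
  have -> : 3 * Num.min 1 (bradius (B t)) = (Num.min 1 (bradius (B t)) / 2) * 6 by field.
  by rewrite [(_ * 6) ^+ m]exprMn; ring.
apply: ler_pM => //; first by apply: tball_meas_ge0 => //; exact: B0.
  by rewrite -natrX -natrM ler_nat card_sphere_le.
by have /andP[] := tball_meas_bounds m0 (B0 t0).
Qed.

(** Shrinking yields [24 ^+ m * a ^ (-k)], and lowering the weight exponent from [w' + k] to [w']
    yields [(g / a) ^ (-k)], with [g] the gcd; the product of the two powers is [g ^ (-k)]. Finally
    [w <= w' + k] allows a return to the exponent [w]. *)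
Lemma pair_term_parallel_le Q a b sg kk kk' : (0 < a)%N -> (a <= b)%N -> absz sg = 1%N ->
  bradius (B a) <= 1 / 2 \/ (a%:R / b%:R) `^ ((w' + k%:R) / m%:R) * bradius (B b) <= 1 / 2 ->
  kk \in parallel_pairs n Q a b sg -> kk' \in parallel_pairs (n + k) Q a b sg ->
  pair_term w' B' a b (qvec kk'.1) (qvec kk'.2) <=
  24 ^+ m * ((gcdn a b)%:R ^+ k)^-1 * pair_term w B a b (qvec kk.1) (qvec kk.2).
Proof.
move=> a0 ab sg1 rsmall /parallel_pairsP[k1a k2b par] /parallel_pairsP[k1a' k2b' par'].
have b0 := leq_trans a0 ab.
have nz (n1 : nat) t (q : {ffun 'I_n1 -> 'I_(2 * Q + 1)}) : (0 < t)%N -> supnorm (qvec q) = t ->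
    exists i, qvec q i != 0.
  by move=> t0 qt; apply: sphere_neq0 t0 _; rewrite in_sphere qt.
have q1 := nz _ _ _ a0 k1a; have q2 := nz _ _ _ b0 k2b.
have q1' := nz _ _ _ a0 k1a'; have q2' := nz _ _ _ b0 k2b'.
have a0R : 0 < a%:R :> R by rewrite ltr0n.
have g0R : 0 < (gcdn a b)%:R :> R by rewrite ltr0n gcdn_gt0 a0.
have ga0 : (gcdn a b)%:R / a%:R != 0 :> R by rewrite gt_eqF // divr_gt0.
have aZ : a%:Z != 0 by rewrite eqz_nat -lt0n.
have bZ : sg * b%:Z != 0 by rewrite -absz_eq0 abszM sg1 mul1n -lt0n.
have /andP[ab0 _] := ratio_itv R a0 ab.
have Wpos : 0 <= ((gcdn a b)%:R / a%:R) `^ w' :> R by exact: powR_ge0.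
apply: (@le_trans _ _ (24 ^+ m * ((gcdn a b)%:R ^+ k)^-1 *
    pair_term (w' + k%:R) B a b (qvec kk.1) (qvec kk.2))); last first.
  apply: ler_wpM2l; last exact: pair_term_le_exponent.
  by rewrite mulr_ge0 ?exprn_ge0 // invr_ge0 exprn_ge0 // ltW.
rewrite /pair_term.
have -> : tscale ((a%:R / b%:R) `^ (w' / m%:R)) (B' b) =
    tscale (shrink R m k a) (tscale ((a%:R / b%:R) `^ ((w' + k%:R) / m%:R)) (B b)).
  by rewrite /B' /tscale /= mulrA shrink_mul // -mulrA.
have := @leb_parallel_shrink R m m0 n (n + k) (qvec kk.1) (qvec kk.2) (qvec kk'.1) (qvec kk'.2)
  (B a) (tscale ((a%:R / b%:R) `^ ((w' + k%:R) / m%:R)) (B b)) a%:Z (sg * b%:Z) (shrink R m k a)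
  q1 q2 q1' q2' aZ bZ par par' (B0 a0).
have r2 : 0 < bradius (tscale ((a%:R / b%:R) `^ ((w' + k%:R) / m%:R)) (B b)).
  by rewrite mulr_gt0 ?powR_gt0 // B0.
move=> /(_ r2 rsmall (shrink_itv R m k a0)) le1.
apply: le_trans (ler_wpM2l Wpos le1) _.
rewrite exprMn shrink_expr // powRD; last by rewrite ga0 implybT.
rewrite powR_mulrn; last by rewrite divr_ge0 ?ltW.
rewrite expr_div_n le_eqVlt; apply/orP; left; apply/eqP; field.
by rewrite !expf_neq0 // gt_eqF.
Qed.

(** If one ball is small, the termwise gain [g ^ (-k)] cancels the growth of the number of parallel
    pairs. If both are large, the second summand on the right dominates. *)
Lemma parallel_sum_le Q a b sg : (0 < a)%N -> (a <= b)%N -> (b <= Q)%N -> absz sg = 1%N ->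
  \sum_(kk in parallel_pairs (n + k) Q a b sg)
    pair_term w' B' a b (qvec kk.1) (qvec kk.2) <=
  c1%:R * 24 ^+ m * (norm_term n w B Q a b +
    #|sphere (n + k) Q a|%:R * tball_meas (B' a) * (#|sphere (n + k) Q b|%:R * tball_meas (B' b))).
Proof.
move=> a0 ab bQ sg1; have b0 := leq_trans a0 ab.
have aQ : (0 < a <= Q)%N by rewrite a0 (leq_trans ab bQ).
have bQ' : (0 < b <= Q)%N by rewrite b0.
set g := gcdn a b; have g0 : (0 < g)%N by rewrite gcdn_gt0 a0.
have ga : (g <= a)%N by rewrite dvdn_leq // dvdn_gcdl.
have gQ : (0 < g <= Q)%N by rewrite g0 (leq_trans ga) //; case/andP: aQ.
have T0 : 0 <= norm_term n w B Q a b by apply: norm_term_ge0.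
have Sa0 : 0 <= #|sphere (n + k) Q a|%:R * tball_meas (B' a).
  by rewrite mulr_ge0 // tball_meas_ge0 // B'0.
have Sb0 : 0 <= #|sphere (n + k) Q b|%:R * tball_meas (B' b).
  by rewrite mulr_ge0 // tball_meas_ge0 // B'0.
have cpar : (#|parallel_pairs (n + k) Q a b sg| <= c1 * g ^ (n + k).-1)%N.
  exact: leq_trans (card_parallel_pairs_le _ aQ bQ' sg1) (card_sphere_le _ gQ).
have [rsmall|rbig] := pselect (bradius (B a) <= 1 / 2 \/
    (a%:R / b%:R) `^ ((w' + k%:R) / m%:R) * bradius (B b) <= 1 / 2).
  apply: (@le_trans _ _ (c1%:R * 24 ^+ m * norm_term n w B Q a b)); last first.
    by rewrite ler_wpM2l ?mulr_ge0 ?exprn_ge0 // lerDl mulr_ge0.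
  set X := \sum_(kk in _) _.
  have gR : 0 < g%:R :> R by rewrite ltr0n.
  (* Double counting: every parallel pair in dimension [n + k] is compared with every one in
     dimension [n], and the two cardinals weigh the sums. *)
  have parX : #|parallel_pairs n Q a b sg|%:R * X <=
      #|parallel_pairs (n + k) Q a b sg|%:R * (24 ^+ m * (g%:R ^+ k)^-1) * norm_term n w B Q a b.
    have -> : #|parallel_pairs n Q a b sg|%:R * X =
      \sum_(kk in parallel_pairs n Q a b sg) X by rewrite sumr_const -[RHS]mulr_natl.
    apply: (@le_trans _ _ (\sum_(kk in parallel_pairs n Q a b sg)
        #|parallel_pairs (n + k) Q a b sg|%:R * (24 ^+ m * (g%:R ^+ k)^-1) *
          pair_term w B a b (qvec kk.1) (qvec kk.2))).
      apply: ler_sum => kk kkP.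
      have -> : #|parallel_pairs (n + k) Q a b sg|%:R * (24 ^+ m * (g%:R ^+ k)^-1) *
          pair_term w B a b (qvec kk.1) (qvec kk.2) =
        \sum_(kk' in parallel_pairs (n + k) Q a b sg) 24 ^+ m * (g%:R ^+ k)^-1 *
          pair_term w B a b (qvec kk.1) (qvec kk.2).
        by rewrite sumr_const -[RHS]mulr_natl; ring.
      by rewrite /X; apply: ler_sum => kk' kkP'; exact: (pair_term_parallel_le a0 ab sg1 rsmall kkP kkP').
    rewrite -mulr_sumr; apply: ler_wpM2l.
      by rewrite mulr_ge0 // mulr_ge0 ?exprn_ge0 // invr_ge0 exprn_ge0.
    rewrite /norm_term [leLHS]big_mkcond [leRHS]big_mkcond; apply: ler_sum => -[k1 k2] _.
    rewrite finset.in_setX !in_sphere; case: ifP => [/parallel_pairsP[/= -> -> _]|_].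
      by rewrite !eqxx.
    case: ifP => // /andP[/= h1 h2]; apply: pair_term_ge0 => //.
      by apply: sphere_neq0 a0 _; rewrite in_sphere.
    by apply: sphere_neq0 b0 _; rewrite in_sphere.
  have X0 : 0 <= X.
    apply: sumr_ge0 => kk /parallel_pairsP[h1 h2 _]; apply: pair_term_ge0 => //.
      by apply: sphere_neq0 a0 _; rewrite in_sphere h1.
    by apply: sphere_neq0 b0 _; rewrite in_sphere h2.
  have gn : 0 < g%:R ^+ n.-1 :> R by rewrite exprn_gt0.
  have gk : 0 < g%:R ^+ k :> R by rewrite exprn_gt0.
  have lo : g%:R ^+ n.-1 * X <= #|parallel_pairs n Q a b sg|%:R * X.
    apply: ler_wpM2r => //; rewrite -natrX ler_nat.
    exact: leq_trans (card_sphere_ge n0 gQ) (card_parallel_pairs_ge _ aQ bQ' sg1).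
  have hi : #|parallel_pairs (n + k) Q a b sg|%:R <= c1%:R * (g%:R ^+ n.-1 * g%:R ^+ k) :> R.
    by rewrite -exprD -nk1 -natrX -natrM ler_nat.
  rewrite -(ler_pM2l gn); apply: le_trans lo (le_trans parX _).
  have -> : g%:R ^+ n.-1 * (c1%:R * 24 ^+ m * norm_term n w B Q a b) =
    c1%:R * (g%:R ^+ n.-1 * g%:R ^+ k) * (24 ^+ m * (g%:R ^+ k)^-1) * norm_term n w B Q a b.
    by field; rewrite gt_eqF.
  apply: ler_wpM2r; first exact: T0.
  apply: ler_wpM2r; last exact: hi.
  by rewrite mulr_ge0 ?exprn_ge0 // invr_ge0 ltW.
have [ra rb] : 1 / 2 < bradius (B a) /\
    1 / 2 < (a%:R / b%:R) `^ ((w' + k%:R) / m%:R) * bradius (B b).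
  by split; rewrite ltNge; apply/negP => h; apply: rbig; [left | right].
have rb2 : 1 / 2 < bradius (B b).
  apply: lt_le_trans rb _; rewrite ler_piMl ?(ltW (B0 b0)) //.
  have e0 : 0 <= (w' + k%:R) / m%:R by rewrite divr_ge0 // addr_ge0.
  by have /andP[] := powR_unit_itv (ratio_itv R a0 ab) e0.
apply: (@le_trans _ _ (c1%:R * 24 ^+ m * (#|sphere (n + k) Q a|%:R * tball_meas (B' a) *
    (#|sphere (n + k) Q b|%:R * tball_meas (B' b))))); last first.
  by rewrite ler_wpM2l ?mulr_ge0 ?exprn_ge0 // lerDr.
(* As [B b] has radius above 1/2, the bound of [shrunk_mass_ge] is at least [(1 / 4) ^+ m], which
   [24 ^+ m] outweighs. *)
have massb : 1 <= 24 ^+ m * (#|sphere (n + k) Q b|%:R * tball_meas (B' b)).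
  have h := shrunk_mass_ge bQ'.
  have mr : 1 / 4 <= Num.min 1 (bradius (B b)) / 2.
    by rewrite /Num.min; case: ifP => _; lra.
  have : 1 <= (24 * (Num.min 1 (bradius (B b)) / 2)) ^+ m by apply: exprn_ege1; lra.
  rewrite exprMn => /le_trans; apply; apply: ler_wpM2l; first by rewrite exprn_ge0.
  apply: le_trans h; rewrite ler_peMl //.
    by rewrite exprn_ge0 //; lra.
  by apply: exprn_ege1; rewrite ler1n.
apply: (@le_trans _ _ (#|parallel_pairs (n + k) Q a b sg|%:R * tball_meas (B' a))).
  have -> : #|parallel_pairs (n + k) Q a b sg|%:R * tball_meas (B' a) =
    \sum_(kk in parallel_pairs (n + k) Q a b sg) tball_meas (B' a).
    by rewrite sumr_const -[RHS]mulr_natl.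
  apply: ler_sum => kk /parallel_pairsP[h1 h2 _]; apply: pair_term_le_tball => //.
    by apply: sphere_neq0 a0 _; rewrite in_sphere h1.
  by apply: sphere_neq0 b0 _; rewrite in_sphere h2.
have tb0 : 0 <= tball_meas (B' a) by rewrite tball_meas_ge0 // B'0.
(* The parallel pairs number at most [c1 * g ^ (n + k).-1], and [g <= a] bounds this by [c1] times
   the cardinal of the sphere of radius [a]. *)
apply: (@le_trans _ _ (c1%:R * (#|sphere (n + k) Q a|%:R * tball_meas (B' a)))).
  rewrite mulrA; apply: ler_wpM2r => //; rewrite -natrM ler_nat.
  apply: leq_trans cpar _; rewrite leq_mul2l; apply/orP; right.
  exact: leq_trans (leq_expn2r _ ga) (card_sphere_ge nk0 aQ).
have -> : c1%:R * 24 ^+ m * (#|sphere (n + k) Q a|%:R * tball_meas (B' a) *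
    (#|sphere (n + k) Q b|%:R * tball_meas (B' b))) =
  c1%:R * (#|sphere (n + k) Q a|%:R * tball_meas (B' a)) *
    (24 ^+ m * (#|sphere (n + k) Q b|%:R * tball_meas (B' b))) by ring.
by rewrite ler_peMr // mulr_ge0.
Qed.

(** Each sign costs [K], hence the constant [1 + 2 * K]. The products [M a * M b] with [a <= b] are
    completed to all [b], which gives the square of [S1]. *)
Lemma S2_shrunk_le : exists2 C : R, 0 < C & forall Q,
  S2 (n + k) w' B' Q <= C * (S2 n w B Q + S1 (n + k) B' Q ^+ 2).
Proof.
pose K : R := c1%:R * 24 ^+ m; have K0 : 0 <= K by rewrite mulr_ge0 // exprn_ge0.
exists (1 + 2 * K) => [|Q]; first by lra.
pose M (t : nat) : R := #|sphere (n + k) Q t|%:R * tball_meas (B' t).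
have M0 t : (0 < t)%N -> 0 <= M t by move=> t0; rewrite mulr_ge0 // tball_meas_ge0 // B'0.
have step (a b : 'I_Q.+1) : (1 <= a)%N -> (a <= b)%N ->
    norm_term (n + k) w' B' Q a b <= (1 + 2 * K) * (norm_term n w B Q a b + M a * M b).
  move=> a0 ab; have bQ : (b <= Q)%N by rewrite -ltnS.
  have b0 := leq_trans a0 ab.
  have h1 := @parallel_sum_le Q a b 1 a0 ab bQ erefl.
  have h2 := @parallel_sum_le Q a b (-1) a0 ab bQ erefl.
  have h3 := norm_term_split (w := w') (B := B') m0 w'0 B'0 (n + k) Q a0 ab.
  have T0 : 0 <= norm_term n w B Q a b by apply: norm_term_ge0.
  by move: h1 h2 h3; rewrite -/K -/(M a) -/(M b); lra.
rewrite !S2E mulrDr S1E expr2 big_distrl /= mulr_sumr mulr_sumr -big_split /=.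
apply: ler_sum => a a0.
have -> : (1 + 2 * K) * (M a * \sum_(t < Q.+1 | (1 <= t)%N) M t) =
   \sum_(b < Q.+1 | (1 <= b)%N) (1 + 2 * K) * (M a * M b).
  by rewrite !mulr_sumr.
apply: (@le_trans _ _ (\sum_(b < Q.+1 | (a <= b)%N)
   (1 + 2 * K) * (norm_term n w B Q a b + M a * M b))).
  by apply: ler_sum => b ab; exact: step.
rewrite mulr_sumr; under eq_bigr do rewrite mulrDr.
rewrite big_split lerD2l [leLHS]big_mkcond [leRHS]big_mkcond.
apply: ler_sum => b _; case: ifP => ab; first by rewrite (leq_trans a0 ab).
have K2 : 0 <= 1 + 2 * K by lra.
by case: ifP => // b0; apply: mulr_ge0 => //; apply: mulr_ge0; apply: M0.
Qed.

(* A diagonal pair of vectors of norm [1] already contributes a positive amount. *)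
Lemma S2_gt0 Q : (0 < Q)%N -> 0 < S2 (n + k) w' B' Q.
Proof.
move=> Q0; rewrite S2E.
pose a : 'I_Q.+1 := Ordinal (Q0 : (1 < Q.+1)%N).
have nt0 (x y : 'I_Q.+1) : (1 <= x)%N -> (x <= y)%N -> 0 <= norm_term (n + k) w' B' Q x y.
  by move=> x0 xy; apply: norm_term_ge0 => //; exact: leq_trans xy.
rewrite (bigD1 a) //=; apply: ltr_pwDl; last first.
  by apply: sumr_ge0 => x /andP[x0 _]; apply: sumr_ge0 => y; exact: nt0.
rewrite (bigD1 a) //=; apply: ltr_pwDl; last first.
  by apply: sumr_ge0 => y /andP[ay _]; apply: (nt0 a).
have : (0 < #|sphere (n + k) Q 1|)%N.
  by have := @card_sphere_ge (n + k) Q 1 nk0 Q0; rewrite exp1n.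
move=> /card_gt0P[k1 k1S]; have q0 := sphere_neq0 (ltn0Sn 0) k1S.
rewrite /norm_term (bigD1 (k1, k1)) /=; last by rewrite finset.in_setX k1S.
apply: ltr_pwDl; last first.
  apply: sumr_ge0 => -[k2 k3] /andP[]; rewrite finset.in_setX => /andP[h1 h2] _.
  by apply: pair_term_ge0 => //; [exact: sphere_neq0 h1 | exact: sphere_neq0 h2].
have B1 : tscale ((1 / 1) `^ (w' / m%:R)) (B' 1) = B' 1.
  by rewrite divr1 powR1 /tscale mul1r; case: (B' 1).
rewrite /pair_term gcdnn B1 setIid divr1 powR1 mul1r leb_Aset //.
have /andP[h _] := tball_meas_bounds m0 (B'0 (ltn0Sn 0)); apply: lt_le_trans h.
by rewrite exprn_gt0 // divr_gt0 // lt_min ltr01 B'0.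
Qed.
End Comparison.

(** * Passage to the upper limit *)

(** For some [e] in (0, 1], [u Q > e] holds for arbitrarily large [Q], and there [v Q >= K * e].
    Choosing [e <= 1] neutralises the truncation and also covers an infinite upper limit. *)
Lemma limn_esup_gt0_le (R : realType) (u v : nat -> R) (K : R) : 0 < K ->
  (forall Q, (0 < Q)%N -> K * Num.min 1 (u Q) <= v Q) ->
  (0 < limn_esup (fun Q => (u Q)%:E))%E -> (0 < limn_esup (fun Q => (v Q)%:E))%E.
Proof.
move=> K0 uv ul.
have [e e0 el] : exists2 e : R, 0 < e <= 1 & (e%:E < limn_esup (fun Q => (u Q)%:E))%E.
  case: (limn_esup _) ul => [l| |] //; last first.
    by move=> _; exists 1; rewrite ?ltr01 ?lexx // ltry.
  rewrite lte_fin => l0; exists (Num.min 1 (l / 2)).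
    by rewrite lt_min ltr01 divr_gt0 //= ge_min lexx.
  by rewrite lte_fin gt_min; apply/orP; right; lra.
have /andP[e00 e1] := e0.
apply: (@lt_le_trans _ _ (K * e)%:E); first by rewrite lte_fin mulr_gt0.
(* The upper limit is an infimum, over the sets [V] of the filter, of suprema over [V]; replacing
   [V] by its positive elements stays within the filter. *)
apply: le_ereal_inf_tmp => _ [V FV <-].
have FW : \oo (V `&` [set Q | (0 < Q)%N]).
  by apply: filterI => //; exists 1%N.
have : (e%:E < ereal_sup [set (u Q)%:E | Q in V `&` [set Q | (0 < Q)%N]])%E.
  apply: lt_le_trans el _; apply: ereal_inf_lbound.
  by exists (V `&` [set Q | (0 < Q)%N]).
move=> /ereal_sup_gt[_ [Q [VQ Q0] <-]]; rewrite lte_fin => eu.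
apply: (@le_trans _ _ (v Q)%:E); last by apply: ereal_sup_ubound; exists Q.
rewrite lee_fin; apply: le_trans (uv Q Q0); apply: ler_wpM2l; first exact: ltW.
by rewrite le_min e1 ltW.
Qed.

Theorem mainTheorem11 (R : realType) (n m : nat) (w : R) (B : nat -> tball R m) :
  (1 <= n)%N -> (1 <= m)%N -> 0 <= w ->
  (forall t : nat, (1 <= t)%N -> 0 < bradius (B t)) ->
  wQIA n w B ->
  forall k : nat,
    wQIA (n + k) (Num.max (w - k%:R) 0)
      (fun t => tscale (t%:R `^ (- (k%:R / m%:R))) (B t)).
Proof.
move=> n0 m0 w0 B0 qia k.
have [c c0 S1le] := S1_shrunk_ge k n0 m0 B0.
have [C C0 S2le] := @S2_shrunk_le R n m k w B n0 m0 B0.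
apply: (limn_esup_gt0_le (K := (C * (c ^- 2 + 1))^-1)) qia => [|Q Q0].
  by rewrite invr_gt0 mulr_gt0 // addr_gt0 // invr_gt0 exprn_gt0.
have S2p := @S2_gt0 R n m k w B n0 m0 B0 Q Q0.
have {S2le} := S2le Q; have {S1le} := S1le Q; move: S2p.
rewrite /shrink; set X := S1 (n + k) _ Q; set Y := S2 (n + k) _ _ Q.
set x := S1 n B Q; set y := S2 n w B Q => Y0 cX YC.
have c20 : 0 < c ^- 2 by rewrite invr_gt0 exprn_gt0.
have D0 : 0 < C * (c ^- 2 + 1) by rewrite mulr_gt0 // addr_gt0.
(* For [y <= 0] the old quotient is at most 0, while the new one is nonnegative. *)
have [y0|y0] := lerP y 0.
  apply: (@le_trans _ _ 0); last by rewrite divr_ge0 ?sqr_ge0 // ltW.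
  rewrite pmulr_rle0 ?invr_gt0 // ge_min; apply/orP; right.
  by rewrite mulr_ge0_le0 ?sqr_ge0 // invr_le0.
(* Truncation at 1 gives both [u <= 1] and [u * y <= x ^+ 2]. Multiplying [Y <= C * (y + X ^+ 2)] by
   [u] then bounds [u * Y] by [C * (x ^+ 2 + X ^+ 2)], hence by [C * (c ^- 2 + 1) * X ^+ 2]. *)
set u := Num.min 1 (x ^+ 2 / y).
have u1 : u <= 1 by rewrite ge_min lexx.
have u0 : 0 <= u by rewrite le_min ler01 divr_ge0 ?sqr_ge0 // ltW.
have uy : u * y <= x ^+ 2 by rewrite -ler_pdivlMr // ge_min lexx orbT.
have x0 : 0 <= x.
  by rewrite /x S1E; apply: sumr_ge0 => t t0; rewrite mulr_ge0 // tball_meas_ge0 // B0.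
have xX : x ^+ 2 <= c ^- 2 * X ^+ 2.
  rewrite mulrC ler_pdivlMr ?exprn_gt0 // mulrC -exprMn.
  by apply: lerXn2r => //; rewrite nnegrE; [rewrite mulr_ge0 // ltW | apply: le_trans cX; rewrite mulr_ge0 // ltW].
have uX : u * X ^+ 2 <= X ^+ 2 by rewrite ler_piMl // sqr_ge0.
rewrite mulrC ler_pdivrMr // mulrAC ler_pdivlMr //.
have : u * Y <= u * (C * (y + X ^+ 2)) by rewrite ler_wpM2l.
have : C * (u * y + u * X ^+ 2) <= C * (c ^- 2 * X ^+ 2 + X ^+ 2).
  by rewrite ler_pM2l // lerD // (le_trans uy).
lra.
Qed.
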